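(* Let $\Sigma$ be a closed oriented cellular surface of genus $g>0$ with edge set $E$, and let $\Sigma^*$ be the dual cellular surface. Suppose $\theta\in(0,\pi)^E$ is a function on the edges of $\Sigma$ which sums to $2\pi$ around each vertex. Identify the edges of $\Sigma$ with the edges of $\Sigma^*$ and consider $\theta$ also as a function on the edges of $\Sigma^*$. There exists a circle pattern in a surface of constant curvature (curvature $-1$ if $g>1$, curvature $0$ if $g=1$), without cone-like singularities, which is combinatorially equivalent to $\Sigma$ and has exterior intersection angles $\theta$, if and only if the following condition is satisfied: Whenever $\Sigma^*$ is cut along a subset of its edges, yielding one or more pieces, then for any piece that is a disc, the sum of $\theta$ over the edges in its boundary is at least $2\pi$, with equality if and only if the piece consists of only one face of $\Sigma^*$ (i.e. one vertex of $\Sigma$). Both the constant curvature surface and the circle pattern are determined up to isometry if $g>1$ and up to similarity if $g=1$.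
   Context: Cellular surface: a cellular decomposition, up to homeomorphism, of a closed connected oriented surface arising from a finite graph embedded in it such that the complement of the graph is a disjoint union of open discs (the faces). Loops and multiple edges are allowed. $\Sigma^*$ is the Poincaré dual decomposition: its faces, edges, vertices correspond to the vertices, edges, faces of $\Sigma$. The sum of $\theta$ around a vertex $v$ is the sum over all oriented edges with initial vertex $v$, so a loop at $v$ is counted twice. Cutting: when $\Sigma^*$ is cut along a subset of its edges, the boundary of a piece means its boundary after cutting, not its boundary as a region in the surface. Thus every cut edge appears exactly twice in the boundaries of the pieces; if the same piece lies on both sides of a cut edge, this edge occurs twice in the boundary of that piece, and $\theta$ of this edge is counted twice. Circle patterns. Let $\theta_e\in(0,\pi)$ be the exterior intersection angles (the interior intersection angles are $\theta^*_e=\pi-\theta_e$). Given positive radii $r_f$ for the faces $f$ of $\Sigma$, take for each edge $e$, with faces $f_j,f_k$ on its two sides, a Euclidean (curvature $0$) or hyperbolic (curvature $-1$) kite-shaped quadrilateral whose vertices are, in cyclic order, the center of the circle $f_j$, one endpoint of $e$, the center of the circle $f_k$, the other endpoint of $e$; its sides have lengths $r_{f_j},r_{f_k},r_{f_k},r_{f_j}$, and its angles at the two vertices corresponding to endpoints of $e$ are both $\theta_e$. Gluing these kites along corresponding sides according to the combinatorics of $\Sigma$ gives a constant curvature surface, possibly with cone-like singularities at the circle centers and at the points corresponding to vertices of $\Sigma$; this surface with the circles of radii $r_f$ is a circle pattern combinatorially equivalent to $\Sigma$ with exterior intersection angles $\theta$. There are no cone-like singularities exactly if the kite angles sum to $2\pi$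 at every circle center (at vertices of $\Sigma$ this is the hypothesis that $\theta$ sums to $2\pi$ around each vertex). *)

(* Defs.v *)
From HB Require Import structures.
From mathcomp Require Import all_boot all_order all_algebra all_fingroup.
From mathcomp Require Import all_classical all_reals all_analysis.
From Stdlib Require Import Relation_Operators.

Set Implicit Arguments.
Unset Strict Implicit.
Unset Printing Implicit Defensive.

Import Order.TTheory GRing.Theory Num.Theory.
Local Open Scope ring_scope.

(* A cellular decomposition of a closed connected oriented surface, up to
   orientation-preserving homeomorphism, is encoded by its rotation system.
   Darts are the oriented edges; [rev] reverses a dart; [rot] sends a dart to
   the next one, counterclockwise, around its initial vertex.  Loops and
   multiple edges are allowed.  The only cellular surface not covered is the
   sphere with one vertex and no edge. *)
Record cellular_surface := CellularSurface {
  dart : finType;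
  rev : {perm dart};
  rot : {perm dart};
  revK : involutive rev;
  rev_neq : forall d, rev d != d;
  dart_gt0 : (0 < #|dart|)%N;
  surface_connected : forall x y,
    connect [rel a b | (b == rev a) || (b == rot a)] x y }.

Definition cycles (T : finType) (s : {perm T}) := {O : {set T} | O \in porbits s}.

Lemma porbit_in_porbits (T : finType) (s : {perm T}) (x : T) :
  porbit s x \in porbits s.
Proof. exact: imset_f. Qed.

Definition cycle_of (T : finType) (s : {perm T}) (x : T) : cycles s :=
  exist _ (porbit s x) (porbit_in_porbits s x).

(* The next dart on the boundary of the face to the left of [d] is obtained by
   turning, at the end of [d], into the clockwise neighbour of [rev d]. *)
Definition next (S : cellular_surface) : {perm dart S} := (rev S * (rot S)^-1)%g.

Definition vertex (S : cellular_surface) := cycles (rot S).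
Definition edge (S : cellular_surface) := cycles (rev S).
Definition face (S : cellular_surface) := cycles (next S).

Definition edge_of (S : cellular_surface) (d : dart S) : edge S :=
  cycle_of (rev S) d.
Definition left_face (S : cellular_surface) (d : dart S) : face S :=
  cycle_of (next S) d.

Definition has_genus (S : cellular_surface) (g : nat) : Prop :=
  #|{: vertex S}|%:Z - #|{: edge S}|%:Z + #|{: face S}|%:Z = 2 - 2 * g%:Z.

(* The Poincare dual.  The dual of a dart [d] crosses [d] from right to left, so
   its initial vertex is the right face of [d] and its left face is the initial
   vertex of [d].  Reversal is unchanged, hence [edge (dual S)] is convertible
   to [edge S]. *)
Lemma dual_connected (S : cellular_surface) (x y : dart S) :
  connect [rel a b | (b == rev S a) || (b == ((rot S)^-1 * rev S)%g a)] x y.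
Proof.
set r' := ((rot S)^-1 * rev S)%g; set e' := [rel a b | _].
apply: (connect_sub _ (surface_connected x y)) => a b /=.
case/orP => /eqP ->; first by apply: connect1; rewrite /= eqxx.
apply: (connect_trans (y := rev S a)); first by apply: connect1; rewrite /= eqxx.
have : fconnect r' (rev S a) (rot S a).
  rewrite fconnect_sym; last exact: perm_inj.
  by apply: connect1; rewrite /= /r' permM permK.
apply: connect_sub => c d /= /eqP <-.
by apply: connect1; rewrite /= eqxx orbT.
Qed.

Definition dual (S : cellular_surface) : cellular_surface :=
  @CellularSurface (dart S) (rev S) ((rot S)^-1 * rev S)%g
    (@revK S) (@rev_neq S) (dart_gt0 S) (@dual_connected S).

(* Faces of the dual are vertices of the surface. *)
Lemma next_dual (S : cellular_surface) : next (dual S) = rot S.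
Proof. by rewrite /next /= invMg invgK mulgA mulgV mul1g. Qed.

(* Cutting a cellular surface [T] along a set [C] of its edges.  A dart [d] also
   stands for the side of its edge that lies on the boundary of [left_face d].
   After cutting, only uncut edges are glued to their other side. *)
Definition cross_fun (T : cellular_surface) (C : {set edge T}) (d : dart T) :=
  if edge_of d \in C then d else rev T d.

Lemma edge_of_rev (T : cellular_surface) (d : dart T) :
  edge_of (rev T d) = edge_of d.
Proof.
apply: val_inj => /=; apply/eqP; rewrite eq_porbit_mem.
by apply/porbitP; exists 1%N; rewrite expg1 ?revK.
Qed.

Lemma cross_inj (T : cellular_surface) (C : {set edge T}) :
  injective (cross_fun C).
Proof.
apply: inv_inj => d; rewrite /cross_fun.
by case: (boolP (edge_of d \in C)) => [-> //|/negbTE]; rewrite edge_of_rev revK => ->.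
Qed.

Definition cross (T : cellular_surface) (C : {set edge T}) : {perm dart T} :=
  perm (@cross_inj T C).

(* A piece is given by the set of all sides of the faces it consists of. *)
Definition is_piece (T : cellular_surface) (C : {set edge T})
    (P : {set dart T}) : Prop :=
  exists x, P = [set y | connect [rel a b | (b == next T a) || (b == cross C a)] x y]%SET.

(* The boundary after cutting: a cut edge with [P] on both sides contributes
   both of its darts. *)
Definition boundary (T : cellular_surface) (C : {set edge T})
    (P : {set dart T}) : {set dart T} :=
  [set d in P | edge_of d \in C]%SET.

(* [walk C] follows the boundary of a face and crosses every uncut edge it
   meets.  Its cycles without cut darts correspond to the vertices in the
   interior of the pieces; a cycle with cut darts runs along one boundary
   component, meeting its boundary edges in order. *)
Definition walk (T : cellular_surface) (C : {set edge T}) : {perm dart T} :=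
  (cross C * next T)%g.

Definition cycles_in (X : finType) (s : {perm X}) (P : {set X}) : {set {set X}} :=
  [set O in porbits s | O \subset P]%SET.

Definition boundary_components (T : cellular_surface) (C : {set edge T})
    (P : {set dart T}) : {set {set dart T}} :=
  [set O in cycles_in (walk C) P | ~~ [disjoint O & boundary C P]]%SET.

(* The genus of a piece is that of the closed surface obtained by filling every
   boundary component with a disc.  Since a boundary component has as many
   vertices as edges, these cancel in the Euler characteristic; what remains is
   the number of interior vertices and filling discs (together, the cycles of
   [walk C]), minus the number of uncut edges, plus the number of faces. *)
Definition piece_has_genus (T : cellular_surface) (C : {set edge T})
    (P : {set dart T}) (h : nat) : Prop :=
  #|cycles_in (walk C) P|%:Z
  - #|[set e : edge T | (e \notin C) && (val e \subset P)]%SET|%:Z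
  + #|cycles_in (next T) P|%:Z = 2 - 2 * h%:Z.

Definition is_disc (T : cellular_surface) (C : {set edge T})
    (P : {set dart T}) : Prop :=
  piece_has_genus C P 0 /\ #|boundary_components C P| = 1%N.

Definition single_face (T : cellular_surface) (P : {set dart T}) : Prop :=
  P \in porbits (next T).

Definition cut_condition (R : realType) (T : cellular_surface)
    (theta : edge T -> R) : Prop :=
  forall (C : {set edge T}) (P : {set dart T}),
    is_piece C P -> is_disc C P ->
    2 * pi <= \sum_(d in boundary C P) theta (edge_of d) /\
    (\sum_(d in boundary C P) theta (edge_of d) = 2 * pi <-> single_face P).

(* The two model planes inside R^3: the affine plane x_0 = 1 and the sheet
   x_0 > 0 of the hyperboloid x_1^2 + x_2^2 - x_0^2 = -1. *)
Variant geometry := Euclidean | Hyperbolic.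

Definition dot (R : realType) (G : geometry) (x y : 'rV[R]_3) : R :=
  let s := x 0 1 * y 0 1 + x 0 2 * y 0 2 in
  if G is Euclidean then s else s - x 0 0 * y 0 0.

Definition in_plane (R : realType) (G : geometry) (x : 'rV[R]_3) : Prop :=
  match G with
  | Euclidean => x 0 0 = 1
  | Hyperbolic => dot G x x = -1 /\ 0 < x 0 0
  end.

Definition arcosh (R : realType) (t : R) : R := ln (t + Num.sqrt (t ^+ 2 - 1)).

Definition dist (R : realType) (G : geometry) (x y : 'rV[R]_3) : R :=
  match G with
  | Euclidean => Num.sqrt (dot G (x - y) (x - y))
  | Hyperbolic => arcosh (- dot G x y)
  end.

(* A tangent vector at [p] pointing along the geodesic from [p] to [a]. *)
Definition direction (R : realType) (G : geometry) (p a : 'rV[R]_3) : 'rV[R]_3 :=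
  match G with
  | Euclidean => a - p
  | Hyperbolic => a + dot G p a *: p
  end.

Definition angle (R : realType) (G : geometry) (p a b : 'rV[R]_3) : R :=
  let u := direction G p a in
  let v := direction G p b in
  acos (dot G u v / (Num.sqrt (dot G u u) * Num.sqrt (dot G v v))).

(* In both models geodesics are cut out by linear subspaces of R^3, so convex
   hulls are the intersections of the plane with positive cones. *)
Definition segment (R : realType) (G : geometry) (a b : 'rV[R]_3) :
    set 'rV[R]_3 :=
  [set x | in_plane G x /\
    exists s t : R, [/\ 0 <= s, 0 <= t & x = s *: a + t *: b]]%classic.

Definition triangle (R : realType) (G : geometry) (a b c : 'rV[R]_3) :
    set 'rV[R]_3 :=
  [set x | in_plane G x /\
    exists s t u : R,
      [/\ 0 <= s, 0 <= t, 0 <= u & x = s *: a + t *: b + u *: c]]%classic.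

(* The data of a circle pattern combinatorially equivalent to [S] with exterior
   intersection angles [theta]: the radii, and for every edge a kite in the
   model plane.  The kite of the edge of [d] has, in cyclic order, the vertices
     [center d]       (centre of the circle of the face to the left of [d]),
     [endpoint d]          (initial vertex of [d]),
     [center (rev d)] (centre of the circle of the face to the right of [d]),
     [endpoint (rev d)]    (terminal vertex of [d]);
   [d] and [rev d] thus label the same kite, placed in the same way. *)
Record circle_pattern (R : realType) (S : cellular_surface)
    (theta : edge S -> R) (G : geometry) := CirclePattern {
  radius : face S -> R;
  center : dart S -> 'rV[R]_3;
  endpoint : dart S -> 'rV[R]_3;
  radius_gt0 : forall f, 0 < radius f;
  center_in_plane : forall d, in_plane G (center d);
  endpoint_in_plane : forall d, in_plane G (endpoint d);
  side_initial : forall d,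
    dist G (center d) (endpoint d) = radius (left_face d);
  side_terminal : forall d,
    dist G (center d) (endpoint (rev S d)) = radius (left_face d);
  endpoint_neq : forall d, endpoint d != endpoint (rev S d);
  endpoint_angle : forall d,
    angle G (endpoint d) (center d) (center (rev S d)) = theta (edge_of d) }.

(* The angle at a centre is the sum of the angles of the two halves of the kite;
   it may exceed pi. *)
Definition center_angle (R : realType) (S : cellular_surface)
    (theta : edge S -> R) (G : geometry) (P : circle_pattern theta G)
    (d : dart S) : R :=
  angle G (center P d) (endpoint P d) (center P (rev S d)) +
  angle G (center P d) (endpoint P (rev S d)) (center P (rev S d)).

Definition no_cone_singularities (R : realType) (S : cellular_surface)
    (theta : edge S -> R) (G : geometry) (P : circle_pattern theta G) : Prop :=
  (forall f : face S, \sum_(d in val f) center_angle P d = 2 * pi) /\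
  (forall v : vertex S,
     \sum_(d in val v)
       angle G (endpoint P d) (center P d) (center P (rev S d)) = 2 * pi).

Definition kite (R : realType) (S : cellular_surface) (theta : edge S -> R)
    (G : geometry) (P : circle_pattern theta G) (d : dart S) :
    set 'rV[R]_3 :=
  (triangle G (center P d) (endpoint P d) (center P (rev S d)) `|`
   triangle G (center P d) (endpoint P (rev S d)) (center P (rev S d)))%classic.

(* The constant curvature surface of a pattern, presented by the pairs [(d, x)]
   with [x] in the kite of [d] (each kite occurs twice, once for each dart). *)
Definition kite_point (R : realType) (S : cellular_surface)
    (theta : edge S -> R) (G : geometry) (P : circle_pattern theta G) :
    set (dart S * 'rV[R]_3) :=
  [set p | kite P p.1 p.2]%classic.

(* The left face of [d] is the right face of [rot d], so the side from
   [endpoint d] to [center d] is glued to the side from [endpoint (rot d)] to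
   [center (rev (rot d))]. *)
Variant glue_step (R : realType) (S : cellular_surface)
    (theta : edge S -> R) (G : geometry) (P : circle_pattern theta G) :
    dart S * 'rV[R]_3 -> dart S * 'rV[R]_3 -> Prop :=
| GlueRev d x : kite P d x -> glue_step P (d, x) (rev S d, x)
| GlueSide d x y :
    segment G (endpoint P d) (center P d) x ->
    segment G (endpoint P (rot S d)) (center P (rev S (rot S d))) y ->
    dist G (endpoint P d) x = dist G (endpoint P (rot S d)) y ->
    glue_step P (d, x) (rot S d, y).

Definition glued (R : realType) (S : cellular_surface)
    (theta : edge S -> R) (G : geometry) (P : circle_pattern theta G) :=
  clos_refl_sym_trans _ (glue_step P).

Inductive broken_geodesic (R : realType) (S : cellular_surface)
    (theta : edge S -> R) (G : geometry) (P : circle_pattern theta G) :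
    dart S * 'rV[R]_3 -> dart S * 'rV[R]_3 -> R -> Prop :=
| BrokenSame p q : kite_point P p -> glued P p q -> broken_geodesic P p q 0
| BrokenSegment d x y :
    kite P d x -> kite P d y -> (segment G x y `<=` kite P d)%classic ->
    broken_geodesic P (d, x) (d, y) (dist G x y)
| BrokenCat p q s l m :
    broken_geodesic P p q l -> broken_geodesic P q s m ->
    broken_geodesic P p s (l + m).

Definition surface_dist (R : realType) (S : cellular_surface)
    (theta : edge S -> R) (G : geometry) (P : circle_pattern theta G)
    (p q : dart S * 'rV[R]_3) : R :=
  inf [set l | broken_geodesic P p q l]%classic.

(* A map between the surfaces of two patterns which scales the distance by
   [lambda] and carries each circle to the corresponding one.  It is described
   kite by kite; the compatibility with the gluings makes it a well-defined
   bijection of the glued surfaces. *)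
Definition similarity (R : realType) (S : cellular_surface)
    (theta : edge S -> R) (G : geometry) (P Q : circle_pattern theta G)
    (lambda : R) (F : dart S -> 'rV[R]_3 -> 'rV[R]_3) : Prop :=
  let F' p := (p.1, F p.1 p.2) in
  [/\ forall d, (F d @` kite P d = kite Q d)%classic,
      forall p q, kite_point P p -> kite_point P q ->
        (glued P p q <-> glued Q (F' p) (F' q)),
      forall p q, kite_point P p -> kite_point P q ->
        surface_dist Q (F' p) (F' q) = lambda * surface_dist P p q,
      forall d, F d (center P d) = center Q d /\
        F d (endpoint P d) = endpoint Q d
    & forall f, radius Q f = lambda * radius P f].

Definition isometric_patterns (R : realType) (S : cellular_surface)
    (theta : edge S -> R) (G : geometry) (P Q : circle_pattern theta G) : Prop :=
  exists F, similarity P Q 1 F.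

Definition similar_patterns (R : realType) (S : cellular_surface)
    (theta : edge S -> R) (G : geometry) (P Q : circle_pattern theta G) : Prop :=
  exists lambda F, 0 < lambda /\ similarity P Q lambda F.

Definition geometry_of_genus (g : nat) : geometry :=
  if g == 1%N then Euclidean else Hyperbolic.

(* Main.v *)
From mathcomp Require Import all_boot all_order all_algebra all_fingroup.
From mathcomp Require Import all_classical all_reals all_analysis.
From mathcomp Require Import ring lra zify.
From Stdlib Require Import Relation_Operators.
Require Import Defs.

(** The kite of an edge is determined by its angle [theta] and its two radii, so a
    pattern is a family of radii solving the closure equations: the angles of the
    kites around each circle centre sum to [2 * pi].  The proof has four parts.

    Combinatorics.  Cut the dual surface along a set of edges.  For every piece,
    the angle [2 * (pi - theta)] that each uncut edge offers, less the angle
    [2 * pi] that each vertex in the interior needs, is expressed through the sum of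
    [theta] over the boundary, the number of boundary components and the Euler
    characteristic of the closed-up piece, which is at most 2 ([piece_euler]).
    Hence the cut condition says exactly that every nonempty set [F'] of faces,
    other than all faces when the genus is 1, satisfies the marriage condition
    [hall]: the incident kites offer more than the faces of [F'] need
    ([hall_of_cut]).  The angles of a pattern
    witness these inequalities, so a pattern implies the cut condition
    ([cut_condition_of_angles]).

    Existence.  For genus at least 2 Perron's method yields the radii: an angle at a
    centre grows with the opposite radius, so the minimum of two supersolutions is
    a supersolution, and the infimum of all of them is a solution unless some radii
    vanish.  Circles shrinking to points would catch all the angle offered by the
    incident kites, contrary to the marriage condition ([hyperbolic_solution]).  For
    genus 1, hyperbolic patterns with cone angles slightly less than [2 * pi] exist
    for the same reason; as the cone angles tend to [2 * pi], the patterns, scaled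
    by the largest radius, converge to a Euclidean one ([euclidean_solution]).

    Uniqueness of the radii is a maximum principle for the ratio of two solutions:
    enlarging a kite does not change its Euclidean angles and strictly decreases its
    hyperbolic ones ([euclidean_radii_unique], [hyperbolic_radii_unique]).

    Geometry.  Both planes are hypersurfaces of a three-dimensional vector space in
    which a nondegenerate triangle is a basis.  The laws of cosines translate
    between distances, angles and inner products ([angle_at_center]), and the linear
    map between the bases given by two similar kites is a similarity of the plane
    ([kite_congruence]).  These maps fit together along the gluings and carry broken
    geodesics to broken geodesics, so they preserve the distance of the glued
    surfaces up to the factor ([kite_maps_similarity]). *)

Set Implicit Arguments.
Unset Strict Implicit.
Unset Printing Implicit Defensive.

Import Order.TTheory GRing.Theory Num.Theory numFieldNormedType.Exports.
Local Open Scope ring_scope.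

(** * Angles of kites *)

Section Angles.
Variable R : realType.
Implicit Types th x y u v a : R.

(** In a Euclidean triangle with sides [1] and [x] enclosing the angle [th], the
    angle opposite to [x].  This expression, unlike the arccotangent of
    [(1 - x * cos th) / (x * sin th)], is continuous at [x = 0], which the limits
    with shrinking circles rely on. *)
Definition opposite_angle th x : R := atan ((x - cos th) / sin th) - th + pi / 2.

Lemma atan_cot a : 0 < a < pi -> atan (cos a / sin a) = pi / 2 - a.
Proof.
move=> /andP[a0 api].
rewrite -[RHS]tanK; last by rewrite in_itv/=; apply/andP; split; lra.
congr atan; rewrite /tan cosB sinB cos_pihalf sin_pihalf; congr (_ / _); ring.
Qed.

Lemma sin_gt0_of th : 0 < th < pi -> 0 < sin th.
Proof. by move=> /andP[? ?]; apply: sin_gt0_pi; apply/andP. Qed.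

Lemma opposite_angle_trig th x : 0 < th < pi ->
  exists2 m, 0 < m & sin (opposite_angle th x) = m * (x * sin th) /\
    cos (opposite_angle th x) = m * (1 - x * cos th).
Proof.
move=> hth; have s0 := sin_gt0_of hth; have cs := cos2Dsin2 th.
set y := (x - cos th) / sin th.
have hy : x - cos th = y * sin th by rewrite /y divfK// gt_eqF.
have ck : 0 < cos (atan y) by apply: cos_gt0_pihalf; rewrite atan_gtNpi2 atan_ltpi2.
have sk : sin (atan y) = y * cos (atan y).
  by rewrite -{2}[y]atanK /tan divfK// gt_eqF.
exists (cos (atan y) / sin th); first exact: divr_gt0.
rewrite /opposite_angle -/y.
rewrite [sin _]sinD [X in _ /\ X = _]cosD sin_pihalf cos_pihalf cosB sinB sk.
have -> : x = y * sin th + cos th by rewrite -hy; ring.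
split; apply: (mulfI (lt0r_neq0 s0)); first by field; rewrite gt_eqF.
have -> : sin th * (cos (atan y) / sin th * (1 - (y * sin th + cos th) * cos th))
  = cos (atan y) * (1 - (y * sin th + cos th) * cos th).
  by field; rewrite gt_eqF.
have -> : 1 - (y * sin th + cos th) * cos th = sin th ^+ 2 - y * sin th * cos th.
  by rewrite -cs; ring.
ring.
Qed.

Lemma opposite_angle0 th : 0 < th < pi -> opposite_angle th 0 = 0.
Proof.
move=> hth; have := atan_cot hth; rewrite /opposite_angle sub0r mulNr atanN => ->.
ring.
Qed.

Lemma lt_opposite_angle th : 0 < th < pi -> {homo opposite_angle th : x y / x < y}.
Proof.
move=> hth x y xy; rewrite /opposite_angle !ltrD2r; apply: lt_atan.
by rewrite ltr_pM2r ?invr_gt0 ?sin_gt0_of// ltrD2r.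
Qed.

Lemma le_opposite_angle th : 0 < th < pi -> {homo opposite_angle th : x y / x <= y}.
Proof.
by move=> hth x y; rewrite le_eqVlt => /predU1P[-> //|/(lt_opposite_angle hth)/ltW].
Qed.

Lemma opposite_angle_inj th : 0 < th < pi -> injective (opposite_angle th).
Proof.
move=> hth x y e; case: (ltgtP x y) => // /(lt_opposite_angle hth); rewrite e ltxx//.
Qed.

Lemma opposite_angle_gt0 th x : 0 < th < pi -> 0 < x -> 0 < opposite_angle th x.
Proof. by move=> hth x0; rewrite -(opposite_angle0 hth); apply: lt_opposite_angle. Qed.

Lemma opposite_angle_lt th x : opposite_angle th x < pi - th.
Proof. by rewrite /opposite_angle; have := atan_ltpi2 ((x - cos th) / sin th); lra. Qed.

(** Scaling the triangle by [x^-1] exchanges its two unknown angles. *)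
Lemma opposite_angleV th x : 0 < th < pi -> 0 < x ->
  opposite_angle th x^-1 = pi - th - opposite_angle th x.
Proof.
move=> hth x0; have := opposite_angle_gt0 hth x0; have := opposite_angle_lt th x.
case/andP: (hth) => t0 t1.
have [m m0] := opposite_angle_trig x hth; set al := opposite_angle th x => -[sE cE] a1 a0.
have /atan_cot : 0 < al < pi by apply/andP; split; lra.
have s0 := sin_gt0_of hth.
rewrite sE cE (_ : _ / _ = (x^-1 - cos th) / sin th).
  by rewrite /(opposite_angle th x^-1) => ->; lra.
by field; rewrite !gt_eqF.
Qed.

Lemma continuous_opposite_angle th : continuous (opposite_angle th).
Proof.
move=> x; apply: cvgD; last exact: cvg_cst.
apply: cvgB; last exact: cvg_cst.
apply: (@continuous_comp _ _ _ (fun x => (x - cos th) / sin th) atan); last first.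
  exact: continuous_atan.
apply: cvgM; last exact: cvg_cst.
by apply: cvgB; [exact: cvg_id|exact: cvg_cst].
Qed.

(** Half of the angle of a kite at the centre of the circle with parameter [u],
    the other circle having parameter [v].  The parameter of a circle of radius
    [r] is [r] in the Euclidean and [tanh (r / 2)] in the hyperbolic plane.  In
    terms of these, the hyperbolic angle is a difference of two Euclidean ones,
    which makes it evidently decrease under scaling of both circles. *)
Definition center_half_angle (G : geometry) th u v : R :=
  opposite_angle th (v / u) -
  (if G is Hyperbolic then opposite_angle th (u * v) else 0).

Definition radius_domain (G : geometry) u : Prop :=
  0 < u /\ (if G is Hyperbolic then u < 1 else True).

(** The same angle in a form that is continuous where [u] vanishes. *)
Lemma center_half_angleE G th u v : 0 < th < pi -> 0 < u -> 0 < v ->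
  center_half_angle G th u v = pi - th - opposite_angle th (u / v) -
    (if G is Hyperbolic then opposite_angle th (u * v) else 0).
Proof.
move=> hth u0 v0; rewrite /center_half_angle; congr (_ - _).
by rewrite -opposite_angleV ?divr_gt0// invf_div.
Qed.

Lemma center_half_angle_gt0 G th u v : 0 < th < pi ->
  radius_domain G u -> radius_domain G v -> 0 < center_half_angle G th u v.
Proof.
move=> hth [u0 u1] [v0 v1]; rewrite /center_half_angle subr_gt0.
case: G u1 v1 => u1 v1; first by apply: opposite_angle_gt0; rewrite ?divr_gt0.
apply: lt_opposite_angle => //; rewrite mulrC ltr_pM2l//.
by apply: (lt_trans u1); rewrite invf_gt1.
Qed.

Lemma center_half_angle_sum G th u v : 0 < th < pi -> 0 < u -> 0 < v ->
  center_half_angle G th u v + center_half_angle G th v u =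
  pi - th - 2 * (if G is Hyperbolic then opposite_angle th (u * v) else 0).
Proof.
move=> hth u0 v0; rewrite (@center_half_angleE G th u v)// /center_half_angle.
by rewrite [v * u]mulrC; case: G; ring.
Qed.

(** The cosine and the sine of [center_half_angle], up to a common positive
    factor; their quotient is the cotangent given by the four-part formula of
    (hyperbolic) trigonometry. *)
Definition half_angle_cos (G : geometry) th u v : R :=
  if G is Hyperbolic then u * (1 + v ^+ 2) - v * (1 + u ^+ 2) * cos th
  else u - v * cos th.
Definition half_angle_sin (G : geometry) th u v : R :=
  if G is Hyperbolic then v * (1 - u ^+ 2) * sin th else v * sin th.

Lemma center_half_angle_trig G th u v : 0 < th < pi ->
  radius_domain G u -> radius_domain G v ->
  exists2 m, 0 < m & sin (center_half_angle G th u v) = m * half_angle_sin G th u v /\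
    cos (center_half_angle G th u v) = m * half_angle_cos G th u v.
Proof.
move=> hth [u0 u1] [v0 v1]; have cs := cos2Dsin2 th.
have [m m0 [sE cE]] := opposite_angle_trig (v / u) hth.
case: G u1 v1 => /= u1 v1.
  exists (m / u); first exact: divr_gt0.
  by rewrite /center_half_angle subr0 sE cE; split; field; rewrite gt_eqF.
have [k k0 [sE' cE']] := opposite_angle_trig (u * v) hth.
exists (m * k / u); first by rewrite divr_gt0 ?mulr_gt0.
rewrite /center_half_angle sinB cosB sE cE sE' cE'; split; first by field; rewrite gt_eqF.
have -> : v * (1 + u ^+ 2) * cos th = v * cos th + v * u ^+ 2 * cos th by ring.
have -> : u * (1 + v ^+ 2) = u + u * v ^+ 2 * (cos th ^+ 2 + sin th ^+ 2).
  by rewrite cs; ring.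
by field; rewrite gt_eqF.
Qed.

Lemma center_half_angle_ltpi G th u v : 0 < th < pi ->
  radius_domain G u -> radius_domain G v -> center_half_angle G th u v < pi.
Proof.
move=> hth [u0 u1] [v0 v1]; rewrite center_half_angleE//.
have := opposite_angle_gt0 hth (divr_gt0 u0 v0); case/andP: (hth) => t0 t1.
case: G u1 v1 => u1 v1; first by lra.
by have := opposite_angle_gt0 hth (mulr_gt0 u0 v0); lra.
Qed.

Lemma center_half_angle_cot G th u v : 0 < th < pi ->
  radius_domain G u -> radius_domain G v ->
  center_half_angle G th u v =
  pi / 2 - atan (half_angle_cos G th u v / half_angle_sin G th u v).
Proof.
move=> hth hu hv; have [m m0 [sE cE]] := center_half_angle_trig hth hu hv.
have /atan_cot : 0 < center_half_angle G th u v < pi.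
  by rewrite center_half_angle_gt0// center_half_angle_ltpi.
have s0 : 0 < sin (center_half_angle G th u v).
  by apply: sin_gt0_pi; rewrite center_half_angle_gt0// center_half_angle_ltpi.
rewrite sE cE -mulf_div divff ?gt_eqF// mul1r => ->; ring.
Qed.

(** In the hyperbolic case the subtracted term of [center_half_angle] grows with
    [v] too; the cotangent formula decides, because [v^-1 + v] decreases on the
    unit interval. *)
Lemma le_center_half_angle G th u v w : 0 < th < pi ->
  radius_domain G u -> radius_domain G v -> radius_domain G w -> v <= w ->
  center_half_angle G th u v <= center_half_angle G th u w.
Proof.
move=> hth hu hv hw vw; case: G hu hv hw => - [u0 u1] [v0 v1] [w0 w1].
  rewrite /center_half_angle !subr0 le_opposite_angle//.
  by rewrite ler_pM2r ?invr_gt0.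
rewrite !center_half_angle_cot// lerD2l lerN2 le_atan//=.
have s0 := sin_gt0_of hth.
have u2 : 0 < 1 - u ^+ 2 by nra.
have E x : 0 < x -> (u * (1 + x ^+ 2) - x * (1 + u ^+ 2) * cos th) /
   (x * (1 - u ^+ 2) * sin th) =
   (u * (x^-1 + x) - (1 + u ^+ 2) * cos th) / ((1 - u ^+ 2) * sin th).
  by move=> x0; field; rewrite !gt_eqF.
rewrite !E// ler_pM2r ?invr_gt0 ?mulr_gt0// lerD2r ler_pM2l// -subr_ge0.
have -> : v^-1 + v - (w^-1 + w) = (w - v) * (1 - v * w) / (v * w).
  by field; rewrite !gt_eqF.
apply: divr_ge0; last by nra.
by apply: mulr_ge0; nra.
Qed.

(** A hyperbolic kite cannot be enlarged without losing angle.  The scaled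
    parameter [k * v] may leave the unit interval, so [w] is compared with [v]. *)
Lemma center_half_angle_scale th u v k w : 0 < th < pi ->
  radius_domain Hyperbolic u -> radius_domain Hyperbolic v ->
  radius_domain Hyperbolic (k * u) -> radius_domain Hyperbolic w ->
  1 < k -> w <= k * v ->
  center_half_angle Hyperbolic th (k * u) w < center_half_angle Hyperbolic th u v.
Proof.
move=> hth hu hv hku hw k1 wkv; have k0 : 0 < k by lra.
have main x : 0 < x -> v <= x -> x <= k * v ->
    center_half_angle Hyperbolic th (k * u) x < center_half_angle Hyperbolic th u v.
  case: hu hv => u0 u1 [v0 v1] x0 vx xkv; apply: ler_ltB.
    apply: le_opposite_angle => //; rewrite invfM mulrA ler_pM2r ?invr_gt0//.
    by rewrite ler_pdivrMr// mulrC.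
  by apply: lt_opposite_angle => //; rewrite -mulrA; have := mulr_gt0 u0 x0; nra.
case: (leP v w) => vw; first by apply: main => //; case: hw.
apply: (@le_lt_trans _ _ (center_half_angle Hyperbolic th (k * u) v)).
  by apply: le_center_half_angle => //; apply: ltW.
by case: (hv) => v0 v1; apply: main => //; nra.
Qed.

End Angles.

(** * Closure equations for the radii *)

Section Faces.
Variable S : cellular_surface.
Implicit Types (d : dart S) (f : face S).

Lemma mem_cycle_of (T : finType) (s : {perm T}) (x : T) (c : cycles s) :
  (x \in val c) = (cycle_of s x == c).
Proof.
case: c => O Ox; rewrite -val_eqE /=; case/imsetP: (Ox) => y _ ->.
by rewrite eq_porbit_mem.
Qed.

Lemma mem_face d f : (d \in val f) = (left_face d == f).
Proof. exact: mem_cycle_of. Qed.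

Lemma face_surj f : exists d, left_face d = f.
Proof.
case: f => O Of; case/imsetP: (Of) => d _ Od; exists d; exact: val_inj.
Qed.

(** The face on the left of [d] is the one on the right of [rot d]. *)
Lemma left_face_rot d : left_face (rev S (rot S d)) = left_face d.
Proof.
apply: val_inj; rewrite /= -(porbit_perm _ 1) expg1.
by rewrite /next permM revK permK.
Qed.

(** Crossing edges connects all faces, because [rot] turns a dart around its
    initial vertex by crossing the edge on its left. *)
Lemma face_connected (p : pred (face S)) :
  (exists f, p f) -> (forall d, p (left_face d) -> p (left_face (rev S d))) ->
  forall f, p f.
Proof.
move=> [f0 p0] step f; have [x xE] := face_surj f0; have [y yE] := face_surj f.
rewrite -yE; have := p0; rewrite -xE; have /connectP[q] := surface_connected x y.
elim: q x {xE} => [|z q IH] x /=; first by move=> _ ->.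
case/andP => /orP[]/eqP-> hq hy px; apply: (IH _ hq hy); first exact: step.
by rewrite -[rot S x](@revK S); apply: step; rewrite left_face_rot.
Qed.

Lemma sum_over_faces (R : realType) (F' : {pred face S}) (g : dart S -> R) :
  \sum_(f in F') \sum_(d in val f) g d = \sum_(d | left_face d \in F') g d.
Proof.
rewrite [RHS](partition_big (@left_face S) (mem F')) //=.
apply: eq_bigr => f fF; apply: eq_bigl => d; rewrite mem_face andbC.
by case: eqP => // ->; rewrite fF.
Qed.

Lemma sum_rev (R : realType) (p : pred (dart S)) (g : dart S -> R) :
  \sum_(d | p d) g d = \sum_(d | p (rev S d)) g (rev S d).
Proof. by rewrite (reindex_inj (@perm_inj _ (rev S))). Qed.

End Faces.

Lemma cvg_finite_sum (R : realType) (T I : Type) (U : set_system T) {FU : Filter U}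
    (r : seq I) (P : pred I) (F : I -> T -> R) (l : I -> R) :
  (forall i, P i -> (F i x @[x --> U] --> l i)%classic) ->
  ((\sum_(i <- r | P i) F i x) @[x --> U] --> \sum_(i <- r | P i) l i)%classic.
Proof.
move=> h; elim: r => [|i r IH].
  rewrite big_nil; under eq_fun do rewrite big_nil; exact: cvg_cst.
rewrite big_cons; under eq_fun do rewrite big_cons.
by case: ifP => // Pi; apply: cvgD => //; apply: h.
Qed.

Section AngleSystem.
Variables (R : realType) (S : cellular_surface) (theta : edge S -> R).
Hypothesis htheta : forall e, 0 < theta e < pi.
Implicit Types (d : dart S) (f : face S) (u v : face S -> R).

Definition dart_angle G u d : R :=
  center_half_angle G (theta (edge_of d)) (u (left_face d)) (u (left_face (rev S d))).

(** The kites of a face contribute twice [dart_angle] each, so a pattern has no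
    cone singularity at the centre of [f] when this sum is [pi]. *)
Definition half_cone_angle G u f : R := \sum_(d in val f) dart_angle G u d.

Definition incident (F' : {set face S}) d :=
  (left_face d \in F') || (left_face (rev S d) \in F').

(** A kite with both centres in [F'] contributes [pi - theta] twice whatever the
    radii are; a kite with just one centre in [F'] falls short of this by the angle
    at its other centre. *)
Lemma sum_shrinking (F' : {set face S}) u (hu : forall f, 0 < u f) :
  \sum_(f in F') \sum_(d in val f)
    2 * opposite_angle (theta (edge_of d)) (u (left_face (rev S d)) / u (left_face d)) =
  \sum_(d | incident F' d) (pi - theta (edge_of d)) -
  2 * \sum_(d | (left_face d \in F') && (left_face (rev S d) \notin F'))
    opposite_angle (theta (edge_of d)) (u (left_face d) / u (left_face (rev S d))).
Proof.
rewrite sum_over_faces.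
pose x d := opposite_angle (theta (edge_of d))
  (u (left_face (rev S d)) / u (left_face d)).
pose y d := opposite_angle (theta (edge_of d))
  (u (left_face d) / u (left_face (rev S d))).
change (\sum_(d | left_face d \in F') 2 * x d =
  \sum_(d | incident F' d) (pi - theta (edge_of d)) -
  2 * \sum_(d | (left_face d \in F') && (left_face (rev S d) \notin F')) y d).
have xE d : x d = pi - theta (edge_of d) - y d.
  by rewrite /x /y -opposite_angleV ?divr_gt0// invf_div.
have yE d : y d = x (rev S d) by rewrite /x /y revK edge_of_rev.
rewrite (bigID (fun d => left_face (rev S d) \in F')) /=.
rewrite [X in X + _](_ : _ = \sum_(d | (left_face d \in F') &&
     (left_face (rev S d) \in F')) (pi - theta (edge_of d))); last first.
  rewrite -mulr_sumr mulrDl mul1r [X in _ + X = _]sum_rev.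
  rewrite [X in _ + X = _](eq_bigl (fun d => (left_face d \in F') &&
    (left_face (rev S d) \in F'))); last by move=> d; rewrite revK andbC.
  rewrite -big_split /=; apply: eq_bigr => d _; rewrite -yE xE; ring.
rewrite -mulr_sumr [X in _ = X - _](bigID (fun d => left_face (rev S d) \in F')) /=.
rewrite [X in _ = X + _ - _](bigID (fun d => left_face d \in F')) /=.
rewrite [X in _ = _ + X + _ - _](_ : _ = \sum_(d | (left_face d \in F') &&
     (left_face (rev S d) \notin F')) (pi - theta (edge_of d))); last first.
  rewrite sum_rev; apply: eq_big => [d|d _]; last by rewrite edge_of_rev.
  by rewrite /incident revK; do 2!case: (_ \in F').
rewrite [X in _ = X + _ + _ - _](_ : _ = \sum_(d | (left_face d \in F') &&
     (left_face (rev S d) \in F')) (pi - theta (edge_of d))); last first.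
  by apply: eq_bigl => d; rewrite /incident; do 2!case: (_ \in F').
rewrite [X in _ = _ + _ + X - _](_ : _ = \sum_(d | (left_face d \in F') &&
     (left_face (rev S d) \notin F')) (pi - theta (edge_of d))); last first.
  by apply: eq_bigl => d; rewrite /incident; do 2!case: (_ \in F').
rewrite -!addrA; congr (_ + _).
under eq_bigr do rewrite xE.
rewrite big_split /= sumrN; ring.
Qed.

(** In a limit of patterns, the circles that shrink to points catch all of the
    angle [pi - theta] of the incident kites: the angle at a centre whose circle
    does not shrink tends to [0].  The term [err] accounts for the difference of
    hyperbolic and Euclidean angles. *)
Lemma shrinking_faces (U : set_system nat) {FU : ProperFilter U}
    (u : nat -> face S -> R) (ustar : face S -> R) (err : nat -> dart S -> R)
    (tau_ : nat -> R) (tau : R) :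
  (forall n f, 0 < u n f) ->
  (forall f, (u n f @[n --> U] --> ustar f)%classic) ->
  (tau_ n @[n --> U] --> tau)%classic ->
  (forall d, ustar (left_face d) = 0 -> (err n d @[n --> U] --> (0 : R))%classic) ->
  (forall n f, ustar f = 0 -> \sum_(d in val f)
    (opposite_angle (theta (edge_of d)) (u n (left_face (rev S d)) / u n (left_face d))
     - err n d) <= tau_ n) ->
  \sum_(d | incident [set f | ustar f == 0]%SET d) (pi - theta (edge_of d)) <=
  2 * tau * #|[set f | ustar f == 0]%SET|%:R.
Proof.
move=> u0 uc tc ec hle; set F' := [set f | _]%SET.
pose s n := \sum_(d | incident F' d) (pi - theta (edge_of d)) -
  2 * \sum_(d | (left_face d \in F') && (left_face (rev S d) \notin F'))
    opposite_angle (theta (edge_of d)) (u n (left_face d) / u n (left_face (rev S d)))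
  - 2 * \sum_(d | left_face d \in F') err n d.
have sc : (s n @[n --> U] --> \sum_(d | incident F' d) (pi - theta (edge_of d)) -
  2 * \sum_(d | (left_face d \in F') && (left_face (rev S d) \notin F')) 0
  - 2 * \sum_(d | left_face d \in F') 0)%classic.
  apply: cvgB; [apply: cvgB; [exact: cvg_cst|]|].
    apply: cvgM; [exact: cvg_cst|apply: cvg_finite_sum => d].
    rewrite !inE => /andP[/eqP d0 d1].
    rewrite -(opposite_angle0 (htheta (edge_of d))).
    apply: (continuous_cvg _ (@continuous_opposite_angle _ _ 0)).
    rewrite -[X in (_ --> X)%classic](mul0r (ustar (left_face (rev S d)))^-1) -d0.
    by apply: cvgM; [exact: uc|apply: cvgV; [|exact: uc]].
  apply: cvgM; [exact: cvg_cst|apply: cvg_finite_sum => d].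
  by rewrite inE => /eqP; exact: ec.
rewrite !big1_eq !mulr0 !subr0 in sc.
have tc2 : (2 * tau_ n * #|F'|%:R @[n --> U] --> 2 * tau * #|F'|%:R)%classic.
  by apply: cvgM; [apply: cvgM; [exact: cvg_cst|]|exact: cvg_cst].
apply: (ler_cvg_to sc tc2); apply: nearW => n.
rewrite /s -sum_shrinking// -sum_over_faces mulr_sumr -sumrB.
have -> : 2 * tau_ n * #|F'|%:R = \sum_(f in F') (2 * tau_ n).
  by rewrite sumr_const mulr_natr.
apply: ler_sum => f; rewrite inE => /eqP f0.
have := hle n f f0; rewrite sumrB => h.
by rewrite -mulr_sumr -mulrBr ler_pM2l.
Qed.

Lemma cvg_half_cone_angle G (T : Type) (U : set_system T) {FU : Filter U}
    (u : T -> face S -> R) (ustar : face S -> R) f :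
  (forall f, 0 < ustar f) -> (forall f, (u n f @[n --> U] --> ustar f)%classic) ->
  (half_cone_angle G (u n) f @[n --> U] --> half_cone_angle G ustar f)%classic.
Proof.
move=> u0 uc; apply: cvg_finite_sum => d _; apply: cvgB.
  apply: (continuous_cvg _ (@continuous_opposite_angle _ _ _)).
  by apply: cvgM => //; apply: cvgV => //; rewrite gt_eqF.
case: G; first exact: cvg_cst.
apply: (continuous_cvg _ (@continuous_opposite_angle _ _ _)).
exact: cvgM.
Qed.

(** Supersolutions of the closure equations.  They are stable under minima because
    an angle grows with the radius of the other circle. *)
Definition superpattern (tau : R) u :=
  (forall f, radius_domain Hyperbolic (u f)) /\
  (forall f, half_cone_angle Hyperbolic u f <= tau).

Lemma le_half_cone_angle G u v f :
  (forall f, radius_domain G (u f)) -> (forall f, radius_domain G (v f)) ->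
  u f = v f -> (forall f', u f' <= v f') ->
  half_cone_angle G u f <= half_cone_angle G v f.
Proof.
move=> hu hv uv le_uv; apply: ler_sum => d; rewrite mem_face => /eqP df.
by rewrite /dart_angle df uv; apply: le_center_half_angle.
Qed.

Lemma superpattern_min tau u v : superpattern tau u -> superpattern tau v ->
  superpattern tau (fun f => Num.min (u f) (v f)).
Proof.
move=> [u1 u2] [v1 v2].
have m1 f : radius_domain Hyperbolic (Num.min (u f) (v f)) by case: leP.
split=> // f; case: (leP (u f) (v f)) => uv.
  apply: le_trans (u2 f); apply: le_half_cone_angle => // [|f'].
    by rewrite min_l.
  by rewrite ge_min lexx.
apply: le_trans (v2 f); apply: le_half_cone_angle => // [|f'].
  by rewrite min_r// ltW.
by rewrite ge_min lexx orbT.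
Qed.

(** Very large hyperbolic kites have very small angles at the centres. *)
Lemma superpattern_exists tau : 0 < tau -> exists u, superpattern tau u.
Proof.
move=> tau0; pose w (t : R) (f : face S) := t.
have wc f : (w t f @[t --> 1^'-] --> (1 : R))%classic by exact: cvg_at_left_filter.
have hc f : (half_cone_angle Hyperbolic (w t) f @[t --> 1^'-] --> (0 : R))%classic.
  rewrite [X in (_ --> X)%classic](_ : 0 = half_cone_angle Hyperbolic (fun=> 1) f).
    by apply: cvg_half_cone_angle.
  apply/esym; rewrite /half_cone_angle big1// => d _.
  by rewrite /dart_angle /center_half_angle divr1 mulr1 subrr.
have h : \forall t \near (1^'-)%classic,
    [/\ 0 < t, t < 1 & forall f, half_cone_angle Hyperbolic (w t) f < tau].
  near=> t; split; [near: t; exact: nbhs_left_gt|near: t; exact: nbhs_left_lt|].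
  by near: t; apply: filter_forall => f; apply: (cvgr_lt _ (hc f)).
have [t [t0 t1 ht]] := filter_ex h.
by exists (w t); split=> // f; apply: ltW.
Unshelve. all: by end_near. Qed.

Definition least_superpattern tau f : R :=
  inf [set u f | u in superpattern tau]%classic.

Lemma least_superpattern_le tau u f : superpattern tau u ->
  least_superpattern tau f <= u f.
Proof.
move=> hu; apply: ge_inf; last by exists u.
by exists 0 => _ [v [hv _] <-]; case: (hv f) => /ltW.
Qed.

Lemma least_superpattern_ge0 tau f : 0 < tau -> 0 <= least_superpattern tau f.
Proof.
move=> /superpattern_exists[u hu]; apply: lb_le_inf; first by exists (u f), u.
by move=> _ [v [hv _] <-]; case: (hv f) => /ltW.
Qed.

Lemma least_superpattern_near tau e (s : seq (face S)) : 0 < tau -> 0 < e ->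
  exists2 u, superpattern tau u &
    forall f, f \in s -> u f < least_superpattern tau f + e.
Proof.
move=> tau0 e0; elim: s => [|f s [u hu IH]].
  by have [u hu] := superpattern_exists tau0; exists u.
have [|_ [v hv <-] hvf] := @inf_adherent _ [set u f | u in superpattern tau]%classic _ e0.
  split; first by exists (u f), u.
  by exists 0 => _ [v [hv _] <-]; case: (hv f) => /ltW.
exists (fun f => Num.min (u f) (v f)); first exact: superpattern_min.
move=> f'; rewrite inE => /predU1P[->|/IH h]; rewrite gt_min ?hvf ?orbT//.
by rewrite h.
Qed.

(** A marriage condition in the sense of Hall: as both darts of an edge are counted,
    the sum is the total angle at the two centres of all incident Euclidean kites,
    while [2 * tau] is the cone angle that each face needs. *)
Definition hall tau := forall F' : {set face S}, F' != finset.set0 ->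
  2 * tau * #|F'|%:R < \sum_(d | incident F' d) (pi - theta (edge_of d)).

(** Perron's method.  The pointwise infimum of the supersolutions, if positive, is a
    solution, since a circle with too small an angle could be shrunk further.  The
    faces where it vanishes would catch all the angle of their kites, which is more
    than [tau] per face by the marriage condition. *)
Lemma hyperbolic_solution tau : 0 < tau -> hall tau ->
  exists2 u, (forall f, radius_domain Hyperbolic (u f)) &
    (forall f, half_cone_angle Hyperbolic u f = tau).
Proof.
move=> tau0 hh; pose m := least_superpattern tau.
have /boolp.choice[u hu] (n : nat) : exists v, superpattern tau v /\
    forall f, v f < m f + harmonic n.
  have [|u hu uf] := @least_superpattern_near tau (harmonic n) (enum {: face S}) tau0.
    by rewrite /= invr_gt0.
  by exists u; split=> // f; apply: uf; rewrite mem_enum.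
have u0 n f : 0 < u n f by case: (hu n) => -[/(_ f)[]].
have uc f : (u n f @[n --> \oo] --> m f)%classic.
  apply: (@squeeze_cvgr _ _ _ _ (fun=> m f) (fun n => m f + harmonic n)).
  - apply: nearW => n; case: (hu n) => h /(_ f)/ltW ->; rewrite andbT.
    exact: least_superpattern_le.
  - exact: cvg_cst.
  - rewrite -[X in (_ --> X)%classic]addr0; apply: cvgD; first exact: cvg_cst.
    exact: cvg_harmonic.
pose err n d := opposite_angle (theta (edge_of d))
  (u n (left_face d) * u n (left_face (rev S d))).
have ec d : m (left_face d) = 0 -> (err n d @[n --> \oo] --> (0 : R))%classic.
  move=> md; rewrite -(opposite_angle0 (htheta (edge_of d))).
  apply: (continuous_cvg _ (@continuous_opposite_angle _ _ 0)).
  by rewrite -[X in (_ --> X)%classic](mul0r (m (left_face (rev S d)))) -md; apply: cvgM.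
have le_tau n f : m f = 0 -> \sum_(d in val f)
    (opposite_angle (theta (edge_of d)) (u n (left_face (rev S d)) / u n (left_face d))
     - err n d) <= tau by move=> _; case: (hu n) => -[_ /(_ f)].
have /= := @shrinking_faces _ eventually_filter _ _ _ _ _ u0 uc (cvg_cst tau) ec le_tau.
set Z := [set f | m f == 0]%SET => hZ.
have m0 f : 0 < m f.
  rewrite lt_neqAle least_superpattern_ge0// andbT eq_sym; apply/negP => mf.
  have /hh : Z != finset.set0 by apply/set0Pn; exists f; rewrite inE.
  by rewrite ltNge hZ.
have m1 f : m f < 1.
  have [v hv] := superpattern_exists tau0.
  by apply: le_lt_trans (least_superpattern_le _ hv) _; case: hv => /(_ f)[].
have mD f : radius_domain Hyperbolic (m f) by [].
have mle f : half_cone_angle Hyperbolic m f <= tau.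
  have hc := @cvg_half_cone_angle Hyperbolic _ _ eventually_filter u m f m0 uc.
  apply: (@cvgr_to_le _ _ _ _ _ _ _ hc).
  by apply: nearW => n; case: (hu n) => -[_ /(_ f)].
exists m => // f0; apply/eqP; rewrite eq_le mle /= leNgt; apply/negP => lt_tau.
pose w t f := if f == f0 then t else m f.
have wc f : (w t f @[t --> (m f0)^'-] --> m f)%classic.
  rewrite /w; case: eqP => [->|_]; first exact: cvg_at_left_filter.
  exact: cvg_cst.
have hc : (half_cone_angle Hyperbolic (w t) f0 @[t --> (m f0)^'-] -->
    half_cone_angle Hyperbolic m f0)%classic by exact: cvg_half_cone_angle.
have h : \forall t \near ((m f0)^'-)%classic,
    [/\ 0 < t, t < m f0 & half_cone_angle Hyperbolic (w t) f0 < tau].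
  near=> t; split; [near: t; exact: nbhs_left_gt|near: t; exact: nbhs_left_lt|].
  by near: t; apply: (cvgr_lt _ hc).
have [t [t0 tm ht]] := filter_ex h.
(* shrinking the circle of [f0] to [t] gives a smaller supersolution *)
have wle f : w t f <= m f by rewrite /w; case: eqP => // ->; exact: ltW.
have wD f : radius_domain Hyperbolic (w t f).
  split; last exact: le_lt_trans (wle f) (m1 f).
  by rewrite /w; case: eqP.
have : superpattern tau (w t).
  split=> // f; have [->|ff] := eqVneq f f0; first exact: ltW.
  by apply: le_trans (mle f); apply: le_half_cone_angle => //; rewrite /w (negbTE ff).
move/(@least_superpattern_le _ _ f0); rewrite /w eqxx -/(m f0).
by rewrite leNgt tm.
Unshelve. all: by end_near. Qed.

Lemma ultra_image_filter (T T' : Type) (h : T -> T') (U : set_system T) :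
  UltraFilter U -> UltraFilter (h x @[x --> U])%classic.
Proof.
move=> UU; split; first exact: fmap_proper_filter.
move=> G PG sub; apply/seteqP; split=> A; last exact: sub.
move=> GA; have [//|hN] := in_ultra_setVsetC (h @^-1` A)%classic UU.
have /(filterI GA) : G (~` A)%classic by apply: sub.
by rewrite setICr => /filter_not_empty.
Qed.

Lemma bounded_ultra_cvg (T : Type) (U : set_system T) (h : T -> R) (a b : R) :
  UltraFilter U -> (forall x, a <= h x <= b) -> exists l : R, (h x @[x --> U] --> l)%classic.
Proof.
move=> UU hab; have := @segment_compact R a b; rewrite compact_ultra.
move=> /(_ (h x @[x --> U])%classic (ultra_image_filter _ UU)) [|l [_ hl]].
  by apply: nearW => x; rewrite /= in_itv/= hab.
by exists l.
Qed.

(** The angles of a triangle sum to at most [pi]. *)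
Lemma dart_angle_sum_le G u d : (forall f, 0 < u f) ->
  dart_angle G u d + dart_angle G u (rev S d) <= pi - theta (edge_of d).
Proof.
move=> u0; rewrite /dart_angle revK edge_of_rev center_half_angle_sum// gerBl mulr_ge0//.
by case: G => //; rewrite ltW// opposite_angle_gt0// mulr_gt0.
Qed.

(** The total angle at all centres, and the part of it that is lost to hyperbolic
    area. *)
Lemma sum_hyperbolic_angles u : (forall f, 0 < u f) ->
  2 * \sum_f half_cone_angle Hyperbolic u f +
  2 * \sum_d opposite_angle (theta (edge_of d)) (u (left_face d) * u (left_face (rev S d)))
  = \sum_d (pi - theta (edge_of d)).
Proof.
move=> u0; rewrite (sum_over_faces predT).
have -> : \sum_(d | left_face d \in predT) dart_angle Hyperbolic u d =
    \sum_d dart_angle Hyperbolic u d by apply: eq_bigl => d; rewrite inE.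
have e : 2 * \sum_d dart_angle Hyperbolic u d = \sum_d (dart_angle Hyperbolic u d +
    dart_angle Hyperbolic u (rev S d)).
  rewrite [RHS]big_split /= mulrDl mul1r; congr (_ + _).
  exact: (sum_rev predT (dart_angle Hyperbolic u)).
rewrite e.
rewrite mulr_sumr -big_split; apply: eq_bigr => d _ /=.
rewrite /dart_angle revK edge_of_rev center_half_angle_sum//; ring.
Qed.

(** Euclidean patterns arise as limits of hyperbolic patterns whose cone angles
    tend to [2 * pi] from below.  The total area of these patterns tends to [0], so
    that after division by the largest radius the angles become Euclidean; the
    marriage condition keeps the smallest of the scaled radii away from [0]. *)
Lemma euclidean_solution :
  \sum_d (pi - theta (edge_of d)) = 2 * pi * #|{: face S}|%:R ->
  (forall F' : {set face S}, F' != finset.set0 -> F' != [set: face S]%SET ->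
    2 * pi * #|F'|%:R < \sum_(d | incident F' d) (pi - theta (edge_of d))) ->
  exists2 u, (forall f, 0 < u f) & (forall f, half_cone_angle Euclidean u f = pi).
Proof.
move=> htot hh; pose tau_ n : R := pi - harmonic n.
have pi2 := @pi_ge2 R.
have h0 n : 0 < harmonic n :> R by rewrite /= invr_gt0.
have h1 n : harmonic n <= 1 :> R by rewrite /= invf_le1// ler1n.
have [x0 _] : exists x : dart S, x \in dart S by apply/card_gt0P; exact: dart_gt0.
pose f0 := left_face x0.
have hall_tau n : hall (tau_ n).
  move=> F' F'0; have c0 : 0 < #|F'|%:R :> R by rewrite ltr0n card_gt0.
  have lt1 : 2 * tau_ n * #|F'|%:R < 2 * pi * #|F'|%:R.
    by rewrite ltr_pM2r// ltr_pM2l// /tau_ gtrBl.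
  apply: (lt_le_trans lt1); have [->|F'T] := eqVneq F' [set: face S]%SET.
    rewrite cardsT -htot le_eqVlt; apply/orP; left; apply/eqP/eq_bigl => d.
    by rewrite /incident inE.
  exact/ltW/hh.
have /boolp.choice[u hu] (n : nat) : exists v, (forall f, radius_domain Hyperbolic (v f)) /\
    (forall f, half_cone_angle Hyperbolic v f = tau_ n).
  have [|v v1 v2] := @hyperbolic_solution (tau_ n) _ (hall_tau n); last by exists v.
  by rewrite /tau_; have := h1 n; lra.
have u0 n f : 0 < u n f by case: (hu n) => /(_ f)[].
pose top n := [arg max_(f > f0) u n f]%O.
have le_top n f : u n f <= u n (top n).
  by rewrite /top; case: arg_maxP => // f' _; apply.
pose w n f := u n f / u n (top n).
have w0 n f : 0 < w n f by rewrite divr_gt0.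
have w1 n f : w n f <= 1 by rewrite ler_pdivrMr// mul1r.
(* a limit along an ultrafilter replaces the choice of a convergent subsequence *)
have [U [UU subU]] := ultraFilterLemma eventually_filter.
have PU : ProperFilter U by exact: ultra_proper.
have /boolp.choice[l hl] (f : face S) : exists l : R, (w n f @[n --> U] --> l)%classic.
  by apply: (@bounded_ultra_cvg _ _ _ 0 1) => // n; rewrite w1 ltW.
have l0 f : 0 <= l f.
  by apply: (cvgr_to_ge (hl f)); apply: nearW => n; exact: ltW.
(* the largest scaled radius is [1], so the limit does not vanish everywhere *)
have lsum : 1 <= \sum_f l f.
  have hs : (\sum_f w n f @[n --> U] --> \sum_f l f)%classic.
    by apply: cvg_finite_sum => f _.
  apply: (cvgr_to_ge hs); apply: nearW => n.
  rewrite (bigD1 (top n))//= {1}/w divff ?gt_eqF// lerDl.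
  by apply: sumr_ge0 => f _; exact: ltW.
pose err n d := opposite_angle (theta (edge_of d))
  (u n (left_face d) * u n (left_face (rev S d))).
have err0 n d : 0 <= err n d by apply/ltW/opposite_angle_gt0 => //; rewrite mulr_gt0.
have err_sum n : \sum_d err n d = harmonic n * #|{: face S}|%:R.
  have := sum_hyperbolic_angles (u0 n); rewrite htot.
  under [X in 2 * X + _]eq_bigr => f _ do case: (hu n) => _ ->.
  rewrite sumr_const -/(err n _) -mulr_natr /tau_ => e.
  by apply: (@mulfI _ 2) => //; rewrite -[LHS]/(2 * \sum_d err n d); lra.
have harmU : (harmonic n @[n --> U] --> (0 : R))%classic.
  by apply: cvg_trans (@cvg_harmonic R) => A; exact: subU.
have ec d : (err n d @[n --> U] --> (0 : R))%classic.
  apply: (@squeeze_cvgr _ _ _ _ (fun=> 0) (fun n => harmonic n * #|{: face S}|%:R)).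
  - apply: nearW => n; rewrite err0 -err_sum (bigD1 d)//= lerDl.
    by apply: sumr_ge0.
  - exact: cvg_cst.
  - rewrite -[X in (_ --> X)%classic](mul0r (#|{: face S}|%:R)).
    by apply: cvgM => //; exact: cvg_cst.
have tauc : (tau_ n @[n --> U] --> (pi : R))%classic.
  by rewrite -[X in (_ --> X)%classic]subr0; apply: cvgB => //; exact: cvg_cst.
have wE n d : w n (left_face (rev S d)) / w n (left_face d) =
    u n (left_face (rev S d)) / u n (left_face d).
  by rewrite /w -mulf_div divff ?mulr1// invr_eq0 gt_eqF.
have angle_eq n f : half_cone_angle Euclidean (w n) f =
    tau_ n + \sum_(d in val f) err n d.
  case: (hu n) => _ /(_ f) <-; rewrite -big_split /=; apply: eq_bigr => d _.
  by rewrite /dart_angle /center_half_angle wE subr0 subrK.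
have ange n f : l f = 0 -> \sum_(d in val f)
    (opposite_angle (theta (edge_of d)) (w n (left_face (rev S d)) / w n (left_face d))
     - err n d) <= tau_ n.
  rewrite sumrB lerBlDr -angle_eq => _; apply: ler_sum => d _.
  by rewrite /dart_angle /center_half_angle subr0.
have := @shrinking_faces U PU w l err tau_ pi w0 hl tauc (fun d _ => ec d) ange.
set Z := [set f | l f == 0]%SET => hZ.
have lpos f : 0 < l f.
  rewrite lt_neqAle l0 andbT eq_sym; apply/negP => lf.
  have Z0 : Z != finset.set0 by apply/set0Pn; exists f; rewrite inE.
  have [ZT|ZT] := eqVneq Z [set: face S]%SET; last first.
    by have := hh _ Z0 ZT; rewrite ltNge hZ.
  move: lsum; rewrite big1 ?ler10// => f' _; apply/eqP.
  have : f' \in Z by rewrite ZT inE.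
  by rewrite inE.
exists l => // f.
have c1 : (half_cone_angle Euclidean (w n) f @[n --> U] -->
    half_cone_angle Euclidean l f)%classic by exact: cvg_half_cone_angle.
have c2 : (half_cone_angle Euclidean (w n) f @[n --> U] --> (pi : R))%classic.
  have c3 : (tau_ n + \sum_(d in val f) err n d @[n --> U] -->
      pi + \sum_(d in val f) (0 : R))%classic.
    by apply: cvgD => //; apply: cvg_finite_sum => d _.
  rewrite big1_eq addr0 in c3.
  by rewrite (_ : (fun n => _) = fun n => tau_ n + \sum_(d in val f) err n d)//; apply/funext.
exact: (cvg_unique _ c1 c2).
Qed.

Lemma max_ratio u v : (forall f, 0 < u f) ->
  exists2 f0, v f0 = (v f0 / u f0) * u f0 & forall f, v f <= (v f0 / u f0) * u f.
Proof.
move=> u0; have [x0 _] : exists x : dart S, x \in dart S by apply/card_gt0P; exact: dart_gt0.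
exists [arg max_(f > left_face x0) (v f / u f)]%O; first by rewrite divfK// gt_eqF.
by case: arg_maxP => // f' _ h f; rewrite -ler_pdivrMr//; apply: h.
Qed.

(** Maximum principle: where the ratio of two families of radii is maximal, no
    angle of the second pattern exceeds that of the first, so all agree and the
    ratio is maximal at the neighbouring faces too. *)
Lemma euclidean_radii_unique u v :
  (forall f, 0 < u f) -> (forall f, 0 < v f) ->
  (forall f, half_cone_angle Euclidean u f = half_cone_angle Euclidean v f) ->
  exists2 k, 0 < k & forall f, v f = k * u f.
Proof.
move=> u0 v0 huv; have [f0 e0 le0] := max_ratio v u0.
set k := v f0 / u f0 in e0 le0; have k0 : 0 < k by rewrite divr_gt0.
clearbody k.
exists k => // f; apply/eqP; move: f; apply: (@face_connected S (fun f => v f == k * u f)).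
  by exists f0; rewrite {1}e0.
move=> d /eqP vd.
have le_d x : left_face x = left_face d ->
    dart_angle Euclidean v x <= dart_angle Euclidean u x.
  move=> xd; rewrite /dart_angle /center_half_angle xd !subr0 vd.
  apply: le_opposite_angle => //; rewrite ler_pdivrMr ?mulr_gt0//.
  rewrite (_ : _ / _ * _ = k * u (left_face (rev S x))); first exact: le0.
  by field; rewrite gt_eqF.
have /eqP := huv (left_face d); rewrite -subr_eq0 -sumrB.
have pos y : y \in val (left_face d) ->
    0 <= dart_angle Euclidean u y - dart_angle Euclidean v y.
  by rewrite mem_face subr_ge0 => /eqP; apply: le_d.
move=> /eqP hz; have dd : d \in val (left_face d) by rewrite mem_face.
have /eqP := psumr_eq0P pos hz dd.
rewrite subr_eq0 /dart_angle /center_half_angle !subr0 => /eqP/(opposite_angle_inj (htheta _)).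
rewrite vd => e; apply/eqP; rewrite -[LHS](@divfK _ (k * u (left_face d))); last first.
  by rewrite gt_eqF ?mulr_gt0.
by rewrite -e; field; rewrite gt_eqF.
Qed.

(** Where the ratio is maximal and exceeds [1], the circle of the face has grown by
    at least the same factor as its neighbours, so [center_half_angle_scale] makes
    every angle of the face strictly smaller. *)
Lemma hyperbolic_radii_le u v :
  (forall f, radius_domain Hyperbolic (u f)) -> (forall f, radius_domain Hyperbolic (v f)) ->
  (forall f, half_cone_angle Hyperbolic u f = half_cone_angle Hyperbolic v f) ->
  forall f, v f <= u f.
Proof.
move=> hu hv huv; have u0 f : 0 < u f by case: (hu f).
have [f0 e0 le0] := max_ratio v u0; set k := v f0 / u f0 in e0 le0.
suff k1 : k <= 1 by move=> f; apply: le_trans (le0 f) _; rewrite ler_piMl// ltW.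
rewrite leNgt; apply/negP => k1; have [x xf] := face_surj f0.
have lt_d d : left_face d = f0 -> dart_angle Hyperbolic v d < dart_angle Hyperbolic u d.
  move=> df; rewrite /dart_angle df e0; apply: center_half_angle_scale => //.
  by rewrite -e0.
have : half_cone_angle Hyperbolic v f0 < half_cone_angle Hyperbolic u f0.
  apply: ltr_sum; first by apply/hasP; exists x; rewrite ?mem_index_enum// mem_face xf.
  by move=> d; rewrite mem_face => /eqP; apply: lt_d.
by rewrite huv ltxx.
Qed.

Lemma hyperbolic_radii_unique u v :
  (forall f, radius_domain Hyperbolic (u f)) -> (forall f, radius_domain Hyperbolic (v f)) ->
  (forall f, half_cone_angle Hyperbolic u f = half_cone_angle Hyperbolic v f) ->
  forall f, v f = u f.
Proof.
by move=> hu hv huv f; apply/eqP; rewrite eq_le !hyperbolic_radii_le.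
Qed.

End AngleSystem.

(** * Pieces of a cut surface *)

Section Permutations.
Variable X : finType.
Implicit Types (s t : {perm X}) (P : {set X}).

Lemma perm_stable s P : (forall x, x \in P -> s x \in P) ->
  forall x, (s x \in P) = (x \in P).
Proof.
move=> h; have e : [set s x | x in P]%SET = P.
  apply/eqP; rewrite eqEcard card_imset ?leqnn ?andbT; last exact: perm_inj.
  by apply/fintype.subsetP => _ /imsetP[x xP ->]; exact: h.
by move=> x; rewrite -{1}e mem_imset//; exact: perm_inj.
Qed.

Lemma iter_stable s P : (forall x, x \in P -> s x \in P) ->
  forall n x, x \in P -> (s ^+ n)%g x \in P.
Proof.
move=> h; elim=> [|n IH] x xP; first by rewrite expg0 perm1.
by rewrite expgS permM; apply/IH/h.
Qed.

Lemma porbit_image s x : porbit s (s x) = porbit s x.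
Proof. by rewrite -[RHS](porbit_perm s 1) expg1. Qed.

Lemma porbit_stable s x y : y \in porbit s x -> s y \in porbit s x.
Proof. by rewrite -!eq_porbit_mem porbit_image. Qed.

Lemma porbit_sub s P x : (forall x, x \in P -> s x \in P) -> x \in P ->
  porbit s x \subset P.
Proof.
by move=> h xP; apply/fintype.subsetP => _ /porbitP[n ->]; exact: iter_stable.
Qed.

Lemma mem_cycles_in s P O : O \in cycles_in s P ->
  exists2 x, x \in P & O = porbit s x.
Proof.
rewrite inE => /andP[/imsetP[x _ ->] /fintype.subsetP h]; exists x => //.
by apply: h; exact: porbit_id.
Qed.

Lemma porbit_in_cycles s P x : (forall x, x \in P -> s x \in P) -> x \in P ->
  porbit s x \in cycles_in s P.
Proof. by move=> h xP; rewrite inE porbit_in_porbits porbit_sub. Qed.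

Lemma porbit_agree s t P x : (forall x, x \in P -> s x \in P) ->
  (forall x, x \in P -> s x = t x) -> x \in P -> porbit s x = porbit t x.
Proof.
move=> h e xP; have E n : (s ^+ n)%g x = (t ^+ n)%g x.
  elim: n x xP => [|n IH] x xP; first by rewrite !expg0.
  by rewrite !expgS !permM -e// IH// h.
by apply/setP => y; apply/porbitP/porbitP => -[n ->]; exists n.
Qed.

Lemma cycles_in_agree s t P : (forall x, x \in P -> s x \in P) ->
  (forall x, x \in P -> s x = t x) -> cycles_in s P = cycles_in t P.
Proof.
move=> hs e; have ht x : x \in P -> t x \in P by move=> xP; rewrite -e// hs.
apply/setP => O; apply/idP/idP => /mem_cycles_in[x xP ->].
  by rewrite (porbit_agree hs e)//; exact: porbit_in_cycles.
by rewrite -(porbit_agree hs e)//; exact: porbit_in_cycles.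
Qed.

Lemma card_porbits_split s P : (forall x, x \in P -> s x \in P) ->
  #|porbits s| = (#|cycles_in s P| + #|cycles_in s (~: P)|)%N.
Proof.
move=> h; have h' x : x \in ~: P -> s x \in ~: P by rewrite !inE (perm_stable h).
rewrite -(cardsID [set O : {set X} | O \subset P]%SET (porbits s)); congr (_ + _)%N.
  by apply: eq_card => O; rewrite !inE.
apply: eq_card => O; apply/idP/idP.
  rewrite !inE => /andP[/negP OP /imsetP[x _ e]]; move: OP; rewrite e => OP.
  rewrite porbit_in_porbits porbit_sub// inE; apply/negP => xP; apply: OP.
  exact: porbit_sub.
case/mem_cycles_in => x; rewrite inE => xP ->; rewrite !inE porbit_in_porbits andbT.
by apply/negP => /fintype.subsetP/(_ x (porbit_id _ _)); apply/negP.
Qed.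

Lemma sum_over_cycles (R : realType) s P (g : X -> R) :
  (forall x, x \in P -> s x \in P) ->
  \sum_(O in cycles_in s P) \sum_(x in O) g x = \sum_(x in P) g x.
Proof.
move=> h; rewrite [RHS](partition_big (porbit s) (mem (cycles_in s P))) /=; last first.
  by move=> x xP; exact: porbit_in_cycles.
apply: eq_bigr => O /mem_cycles_in[x xP ->]; apply: eq_bigl => y.
rewrite eq_porbit_mem andbC; case: (boolP (y \in porbit s x)) => //= yx.
by rewrite (fintype.subsetP (porbit_sub h xP)).
Qed.

End Permutations.

Section Pieces.
Variable T : cellular_surface.
Implicit Types (C X Y : {set edge T}) (P W : {set dart T}) (d x y : dart T) (e : edge T).

Lemma mem_edge e d : (d \in val e) = (edge_of d == e).
Proof.
case: e => O Ox; rewrite -val_eqE /=; case/imsetP: (Ox) => y _ ->.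
by rewrite eq_porbit_mem.
Qed.

Lemma edge_surj e : exists d, edge_of d = e.
Proof. by case: e => O Oe; case/imsetP: (Oe) => d _ Od; exists d; exact: val_inj. Qed.

Lemma edge_of_eq d x : (edge_of x == edge_of d) = (x == d) || (x == rev T d).
Proof.
rewrite -mem_edge /=; apply/porbitP/orP; last first.
  by case=> /eqP->; [exists 0%N; rewrite expg0 perm1|exists 1%N; rewrite expg1].
case=> n ->; elim: n => [|n IH]; first by rewrite expg0 perm1 eqxx; left.
rewrite expgSr permM; case: IH => /eqP->; first by right.
by left; rewrite revK.
Qed.

Lemma crossE C d : cross C d = if edge_of d \in C then d else rev T d.
Proof. by rewrite permE. Qed.

Lemma walkE C d : walk C d = next T (cross C d).
Proof. by rewrite permM. Qed.

Lemma next_rev_stable P : (forall d, d \in P -> next T d \in P) ->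
  (forall d, d \in P -> rev T d \in P) -> P = finset.set0 \/ P = [set: dart T]%SET.
Proof.
move=> hn hr; have [->|/set0Pn[x xP]] := eqVneq P finset.set0; [by left|right].
apply/setP => y; rewrite inE; have /connectP[q] := surface_connected x y.
elim: q x xP => [|z q IH] x xP /=; first by move=> _ ->.
case/andP => /orP[]/eqP-> hq hy; apply: (IH _ _ hq hy); first exact: hr.
rewrite -[rot T x](@revK T) hr// -(perm_stable hn) /next permM revK permK.
exact: xP.
Qed.

Definition adjacent C := [rel a b | (b == next T a) || (b == cross C a)].

Definition piece_of C x : {set dart T} := [set y | connect (adjacent C) x y]%SET.

Lemma adjacent_sym C : connect_sym (adjacent C).
Proof.
have back (s : {perm dart T}) a : (forall x, adjacent C x (s x)) ->
    connect (adjacent C) (s a) a.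
  move=> h; have : fconnect s (s a) a.
    rewrite fconnect_sym; last exact: perm_inj.
    by apply: connect1; rewrite /= eqxx.
  by apply: connect_sub => b c /= /eqP <-; apply: connect1; exact: h.
have sub a b : connect (adjacent C) a b -> connect (adjacent C) b a.
  case/connectP => q; elim: q a => [|c q IH] a /=; first by move=> _ ->.
  case/andP => ac hq hb; apply: connect_trans (IH _ hq hb) _.
  by case/orP: ac => /eqP->; apply: back => x; rewrite /= eqxx ?orbT.
by move=> a b; apply/idP/idP; apply: sub.
Qed.

Lemma piece_of_refl C x : x \in piece_of C x. Proof. by rewrite inE connect0. Qed.

Lemma mem_piece_of C x y : (y \in piece_of C x) = (piece_of C y == piece_of C x).
Proof.
apply/idP/eqP => [|<-]; last exact: piece_of_refl.
rewrite inE => xy; apply/setP => z; rewrite !inE.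
apply/idP/idP; first exact: connect_trans.
by apply: connect_trans; rewrite adjacent_sym.
Qed.

Lemma piece_of_is_piece C x : is_piece C (piece_of C x).
Proof. by exists x. Qed.

Lemma piece_next C P d : is_piece C P -> d \in P -> next T d \in P.
Proof.
case=> x ->; rewrite !inE => h; apply: connect_trans h (connect1 _).
by rewrite /= eqxx.
Qed.

Lemma piece_cross C P d : is_piece C P -> d \in P -> cross C d \in P.
Proof.
case=> x ->; rewrite !inE => h; apply: connect_trans h (connect1 _).
by rewrite /= eqxx orbT.
Qed.

Lemma piece_walk C P d : is_piece C P -> d \in P -> walk C d \in P.
Proof. by move=> hP dP; rewrite walkE; apply/(piece_next hP)/(piece_cross hP). Qed.

Lemma piece_rev C P d : is_piece C P -> edge_of d \notin C -> (rev T d \in P) = (d \in P).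
Proof.
move=> hP dC; have sub x : edge_of x \notin C -> x \in P -> rev T x \in P.
  by move=> xC /(piece_cross hP); rewrite crossE (negbTE xC).
apply/idP/idP; last exact: sub.
by rewrite -{2}[d](@revK T); apply: sub; rewrite edge_of_rev.
Qed.

Lemma piece_neq0 C P : is_piece C P -> exists d, d \in P.
Proof. by case=> x ->; exists x; rewrite inE connect0. Qed.

Lemma piece_connected C P W : is_piece C P -> (exists2 d, d \in P & d \in W) ->
  (forall d, d \in W -> next T d \in W) -> (forall d, d \in W -> cross C d \in W) ->
  P \subset W.
Proof.
move=> [x ->] [d]; rewrite inE => xd dW hn hc; apply/fintype.subsetP => y; rewrite inE.
rewrite adjacent_sym => yx; have {yx xd} := connect_trans yx xd.
rewrite adjacent_sym; case/connectP => q.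
elim: q d dW => [|z q IH] d dW /=; first by move=> _ ->.
by case/andP => /orP[]/eqP-> hq hy; apply: (IH _ _ hq hy); [exact: hn|exact: hc].
Qed.

Definition inner_edges C P : {set edge T} := [set e | (e \notin C) && (val e \subset P)]%SET.

Lemma edge_subset d P : (val (edge_of d) \subset P) = (d \in P) && (rev T d \in P).
Proof.
apply/fintype.subsetP/andP => [h|[h1 h2] x].
  by split; apply: h; rewrite mem_edge ?edge_of_rev.
by rewrite mem_edge edge_of_eq => /orP[]/eqP->.
Qed.

Lemma mem_inner_edges C P d : is_piece C P ->
  (edge_of d \in inner_edges C P) = (edge_of d \notin C) && (d \in P).
Proof.
move=> hP; rewrite inE edge_subset; case: (boolP (edge_of d \in C)) => //= dC.
by rewrite (piece_rev hP)// andbb.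
Qed.

(** Gluing the two sides of one more edge composes [cross] with a transposition;
    so it merges two cycles of [walk] if the sides lie on distinct ones and splits
    a cycle otherwise. *)
Lemma card_walk_glue X d : edge_of d \notin X ->
  (#|porbits (walk (~: (edge_of d |: X)))| +
     (d \notin porbit (walk (~: X)) (rev T d)).*2 = #|porbits (walk (~: X))| + 1)%N.
Proof.
move=> dX; have e : cross (~: (edge_of d |: X)%SET) = (tperm d (rev T d) * cross (~: X))%g.
  apply/permP => x; rewrite permM !crossE !inE.
  case: tpermP => [->|->|/eqP xd /eqP xr]; rewrite ?edge_of_rev ?eqxx ?dX //= ?revK//.
  by rewrite edge_of_eq (negbTE xd) (negbTE xr).
rewrite /walk e -(mulgA (tperm _ _)).
by rewrite porbits_mul_tperm eq_sym rev_neq.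
Qed.

Lemma card_walk_mono X Y : X \subset Y ->
  (#|porbits (walk (~: Y))| <= #|porbits (walk (~: X))| + (#|Y| - #|X|))%N.
Proof.
have [n] := ubnP (#|Y| - #|X|); elim: n X => // n IH X hn XY.
have [->|] := eqVneq X Y; first by rewrite leq_addr.
move=> XneY; have : X \proper Y by rewrite finset.properEneq XneY.
case/properP => _ [e eY eX]; have [d de] := edge_surj e; rewrite -de in eX eY.
have XY' : edge_of d |: X \subset Y by rewrite finset.subUset finset.sub1set eY.
have c : (#|edge_of d |: X| = #|X|.+1)%N by rewrite cardsU1 eX.
have := subset_leq_card XY'; rewrite c => lt.
have aux1 (a b m : nat) : (a - b < m.+1 -> b < a -> a - b.+1 < m)%N by lia.
have hn' : (#|Y| - #|edge_of d |: X| < n)%N by rewrite c; exact: aux1 hn lt.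
have aux2 (a b w w1 w2 k : nat) :
  (w1 + k = w2 + 1 -> w <= w1 + (a - b.+1) -> b < a -> w <= w2 + (a - b))%N by lia.
by have := IH _ hn' XY'; rewrite c => /(aux2 _ _ _ _ _ _ (card_walk_glue eX)); apply.
Qed.

Lemma glue_tree_count (w1 w2 a b : nat) :
  (w1 + 2 = w2 + 1 -> w2 + a = b -> w1 + (1 + a) = b)%N.
Proof. lia. Qed.

(** A piece can be assembled from its faces by gluing along the edges of a spanning
    tree of its dual graph; each of these gluings merges two cycles of [walk].  In
    the induction, [W] consists of the faces reached so far. *)
Lemma piece_tree C P : is_piece C P -> exists X,
  [/\ X \subset inner_edges C P,
   (#|porbits (walk (~: X))| + #|X| = #|porbits (next T)|)%N &
   (#|cycles_in (next T) P| = #|X|.+1)%N].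
Proof.
move=> hP; have [x xP] := piece_neq0 hP.
suff H n : exists X W, [/\ X \subset inner_edges C P,
   (#|porbits (walk (~: X))| + #|X| = #|porbits (next T)|)%N,
   (#|cycles_in (next T) W| = #|X|.+1)%N,
   [/\ x \in W, W \subset P, forall d, d \in W -> next T d \in W &
     forall d, edge_of d \in X -> d \in W] & W = P \/ (n <= #|W|)%N].
  have [X [W [XE c1 c2 [xW WP _ _] h]]] := H #|P|; exists X; split=> //.
  have -> : P = W by case: h => // h; apply/esym/eqP; rewrite eqEcard WP.
  exact: c2.
elim: n => [|n [X [W [XE c1 c2 [xW WP Wn Wr] h]]]].
  exists finset.set0, (porbit (next T) x).
  have stab d := @porbit_stable _ (next T) x d.
  split=> //; last by right.
  - by rewrite finset.sub0set.
  - rewrite cards0 addn0; suff -> : walk (~: finset.set0) = next T by [].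
    by apply/permP => d; rewrite walkE crossE !inE.
  - rewrite cards0; apply/eqP/cards1P; exists (porbit (next T) x).
    apply/setP => O; rewrite finset.in_set1; apply/idP/eqP => [/mem_cycles_in[y yx ->]|->].
      by apply/eqP; rewrite eq_porbit_mem.
    exact: porbit_in_cycles (porbit_id _ _).
  - split=> //; first exact: porbit_id.
      by apply: porbit_sub => // d; exact: (piece_next hP).
    by move=> d; rewrite inE.
have [WeP|WneP] := eqVneq W P; first by exists X, W; split=> //; left.
have [d dW cW] : exists2 d, d \in W & cross C d \notin W.
  apply/exists_inP; apply: contraNT WneP; rewrite negb_exists_in => /forall_inP hc.
  rewrite finset.eqEsubset WP; apply: (piece_connected hP) => [|//|d dW].
    by exists x => //; rewrite (fintype.subsetP WP).
  by have := hc d dW; rewrite negbK.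
have dC : edge_of d \notin C.
  by apply/negP => dC; move: cW; rewrite crossE dC dW.
have rW : rev T d \notin W by move: cW; rewrite crossE (negbTE dC).
have dP : d \in P by exact: (fintype.subsetP WP).
have dX : edge_of d \notin X.
  by apply/negP => dX; move: rW; rewrite Wr// edge_of_rev.
pose O := porbit (next T) (rev T d).
have rP : rev T d \in P by rewrite (piece_rev hP).
have OP : O \subset P by apply: porbit_sub => // y; exact: (piece_next hP).
have On y : y \in O -> next T y \in O by exact: porbit_stable.
have rO : rev T d \in O by exact: porbit_id.
have Wn' y : y \in W :|: O -> next T y \in W :|: O.
  by rewrite !inE => /orP[/Wn->|/On->]; rewrite ?orbT.
have W'P : W :|: O \subset P by rewrite finset.subUset WP.
exists (edge_of d |: X), (W :|: O); split.
- by rewrite finset.subUset finset.sub1set XE mem_inner_edges// dC dP.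
- have hd : d \notin porbit (walk (~: X)) (rev T d); last first.
    have := card_walk_glue dX; rewrite hd cardsU1 dX => h1.
    exact: glue_tree_count h1 c1.
  apply/negP; rewrite porbit_sym => hr; move/negP: rW; apply.
  have wW y : y \in W -> walk (~: X) y \in W.
    move=> yW; rewrite walkE crossE !inE; apply: Wn.
    by case: (boolP (edge_of y \in X)) => //= yX; apply: Wr; rewrite edge_of_rev.
  by move: hr; apply: fintype.subsetP; exact: porbit_sub.
- rewrite cardsU1 dX.
  have -> : cycles_in (next T) (W :|: O) = O |: cycles_in (next T) W.
    apply/setP => Q; rewrite finset.in_setU1; apply/idP/orP.
      case/mem_cycles_in => y; rewrite inE => /orP[yW ->|yO ->].
        by right; exact: porbit_in_cycles.
      by left; rewrite eq_porbit_mem.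
    case=> [/eqP->|/mem_cycles_in[y yW ->]]; apply: porbit_in_cycles => //.
      by rewrite inE rO orbT.
    by rewrite inE yW.
  rewrite cardsU1 c2; suff -> : O \notin cycles_in (next T) W by [].
  by rewrite inE negb_and; apply/orP; right; apply: contra rW => /fintype.subsetP; apply.
- split=> //; first by rewrite inE xW.
  move=> y; rewrite !inE edge_of_eq => /orP[/orP[]/eqP->|/Wr->//].
    by rewrite dW.
  by rewrite rO orbT.
- case: h => [/eqP|h]; first by rewrite (negbTE WneP).
  right; apply: leq_ltn_trans h (proper_card _); apply/properP; split.
    exact: finset.subsetUl.
  by exists (rev T d); rewrite // inE rO orbT.
Qed.


(** The surface obtained by filling the boundary components with discs has Euler
    characteristic at most 2: after gluing along a spanning tree there is one
    [walk] cycle on the piece, and every further edge adds at most one. *)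
Lemma piece_euler C P : is_piece C P ->
  (#|cycles_in (walk C) P| + #|cycles_in (next T) P| <= #|inner_edges C P| + 2)%N.
Proof.
move=> hP; have [X [XE c1 c2]] := piece_tree hP.
set Y := inner_edges C P in XE *.
have e1 x : x \in P -> walk C x = walk (~: Y) x.
  move=> xP; rewrite !walkE !crossE finset.in_setC mem_inner_edges// xP andbT.
  by case: (edge_of x \in C).
have e2 x : x \in ~: P -> walk (~: Y) x = next T x.
  rewrite inE => /negbTE xP; rewrite !walkE !crossE finset.in_setC mem_inner_edges// xP.
  by rewrite andbF.
have s1 x : x \in P -> walk C x \in P by exact: piece_walk.
have s2 x : x \in P -> walk (~: Y) x \in P by move=> xP; rewrite -e1// s1.
have s3 x : x \in P -> next T x \in P by exact: (piece_next hP).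
have s4 x : x \in ~: P -> walk (~: Y) x \in ~: P.
  by rewrite !inE (perm_stable s2).
have := card_walk_mono XE; rewrite (card_porbits_split s2) (cycles_in_agree s4 e2).
rewrite -(cycles_in_agree s1 e1); move: c1 (subset_leq_card XE).
rewrite (card_porbits_split s3) c2.
have aux (w x q y a : nat) : (w + x = x.+1 + q -> x <= y -> a + q <= w + (y - x) ->
  a + x.+1 <= y + 2)%N by lia.
exact: aux.
Qed.

(** The vertices in the interior of a piece. *)
Definition interior_cycles C P : {set {set dart T}} :=
  [set O in cycles_in (walk C) P | [disjoint O & boundary C P]]%SET.

Lemma card_interior_cycles C P :
  #|cycles_in (walk C) P| = (#|interior_cycles C P| + #|boundary_components C P|)%N.
Proof.
rewrite -(cardsID [set O : {set dart T} | [disjoint O & boundary C P]]%SET).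
by congr (_ + _)%N; apply: eq_card => O; rewrite !inE 1?andbC// andbA.
Qed.

Lemma boundary_components_gt0 C P : is_piece C P ->
  (0 < #|boundary_components C P|)%N = (boundary C P != finset.set0).
Proof.
move=> hP; rewrite card_gt0; apply/set0Pn/set0Pn.
  by case=> O; rewrite inE => /andP[_ /pred0Pn[d /andP[_ dB]]]; exists d.
case=> d dB; exists (porbit (walk C) d); rewrite inE; apply/andP; split.
  apply: porbit_in_cycles => [x|]; first exact: piece_walk.
  by move: dB; rewrite inE => /andP[].
by apply/pred0Pn; exists d; rewrite /= porbit_id.
Qed.

Definition uncut C P : {set dart T} := [set d in P | edge_of d \notin C]%SET.

(** Without cut darts the piece is stable under [rev] as well as [next]. *)
Lemma boundary_eq0 C P : is_piece C P -> boundary C P = finset.set0 ->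
  P = [set: dart T]%SET /\ C = finset.set0.
Proof.
move=> hP B0; have nC d : d \in P -> edge_of d \notin C.
  by move=> dP; apply/negP => dC; have := finset.in_set0 d; rewrite -B0 inE dP dC.
have PT : P = [set: dart T]%SET.
  case: (@next_rev_stable P) => // [d|d dP|P0]; first exact: (piece_next hP).
    by rewrite (piece_rev hP)// nC.
  by have [d] := piece_neq0 hP; rewrite P0 inE.
split=> //; apply/setP => e; rewrite inE; have [d <-] := edge_surj e.
by apply/negbTE/nC; rewrite PT inE.
Qed.

(** Without uncut darts the piece is connected by [next] alone. *)
Lemma uncut_eq0 C P : is_piece C P -> uncut C P = finset.set0 -> single_face P.
Proof.
move=> hP U0; have [x xP] := piece_neq0 hP.
have cE d : d \in P -> cross C d = d.
  move=> dP; rewrite crossE; case: ifP => // /negbT dC.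
  by have := finset.in_set0 d; rewrite -U0 inE dP dC.
have xsub := porbit_sub (fun d => piece_next hP (d := d)) xP.
suff -> : P = porbit (next T) x by exact: porbit_in_porbits.
apply/eqP; rewrite finset.eqEsubset xsub andbT; apply: (piece_connected hP).
- by exists x => //; exact: porbit_id.
- by move=> d; exact: porbit_stable.
- by move=> d dx; rewrite cE// (fintype.subsetP xsub).
Qed.

Lemma card_uncut C P : is_piece C P -> #|uncut C P| = (2 * #|inner_edges C P|)%N.
Proof.
move=> hP; rewrite -sum1_card.
rewrite (partition_big (@edge_of T) (mem (inner_edges C P))) /=; last first.
  by move=> d; rewrite mem_inner_edges// inE andbC.
rewrite mulnC -sum_nat_const; apply: eq_bigr => e; have [d <-] := edge_surj e.
rewrite mem_inner_edges// => /andP[dC dP]; rewrite sum1_card.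
rewrite -[RHS](_ : #|[set d; rev T d]%SET| = 2%N); last by rewrite cards2 eq_sym rev_neq.
apply: eq_card => y; rewrite [LHS]unfold_in /= edge_of_eq !inE andbC.
case: (eqVneq y d) => [->|yd] /=; first by rewrite dP dC.
case: (eqVneq y (rev T d)) => [->|//] /=.
by rewrite (piece_rev hP)// dP edge_of_rev dC.
Qed.

End Pieces.

Section CutCondition.
Variables (R : realType) (T : cellular_surface) (theta : edge T -> R).
Hypothesis htheta : forall e, 0 < theta e < pi.
Hypothesis hsum : forall x, \sum_(d in porbit (next T) x) theta (edge_of d) = 2 * pi.
Implicit Types (C : {set edge T}) (P : {set dart T}) (d : dart T).

Lemma sum_piece C P : is_piece C P ->
  \sum_(d in P) theta (edge_of d) = 2 * pi * #|cycles_in (next T) P|%:R.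
Proof.
move=> hP; rewrite -(@sum_over_cycles _ _ (next T)); last by move=> d; exact: (piece_next hP).
rewrite mulr_natr -sumr_const; apply: eq_bigr => O /mem_cycles_in[x _ ->].
exact: hsum.
Qed.

Lemma sum_piece_split C P (g : dart T -> R) :
  \sum_(d in P) g d = \sum_(d in boundary C P) g d + \sum_(d in uncut C P) g d.
Proof.
rewrite (bigID (fun d => edge_of d \in C)) /=.
by congr (_ + _); apply: eq_bigl => d; rewrite inE.
Qed.

(** An inner edge consists of two uncut darts, and [theta] sums to [2 * pi] over
    each face. *)
Lemma sum_uncut C P : is_piece C P ->
  \sum_(d in uncut C P) (pi - theta (edge_of d)) =
  \sum_(d in boundary C P) theta (edge_of d) +
  2 * pi * (#|inner_edges C P|%:R - #|cycles_in (next T) P|%:R).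
Proof.
move=> hP; rewrite sumrB sumr_const (card_uncut hP) -[pi *+ _]mulr_natr natrM.
have := sum_piece hP; rewrite (sum_piece_split C) => e.
by rewrite mulrBr -e; ring.
Qed.

Lemma sum_uncut_gt0 C P : uncut C P != finset.set0 ->
  0 < \sum_(d in uncut C P) theta (edge_of d).
Proof.
case/set0Pn => d dU; rewrite (bigD1 d)//=; case/andP: (htheta (edge_of d)) => t0 _.
by rewrite ltr_wpDr// sumr_ge0// => x _; case/andP: (htheta (edge_of x)) => /ltW.
Qed.

(** By [sum_uncut], the right hand side exceeds the left hand side by the sum of
    [theta] over the boundary plus [2 * pi] times the number of boundary components
    minus the Euler characteristic of the closed-up piece.  This is positive except
    possibly for discs, and for these the cut condition applies. *)
Lemma cut_condition_piece C P : cut_condition theta ->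
  is_piece C P -> boundary C P != finset.set0 ->
  2 * pi * #|interior_cycles C P|%:R <= \sum_(d in uncut C P) (pi - theta (edge_of d)) /\
  (uncut C P != finset.set0 ->
   2 * pi * #|interior_cycles C P|%:R < \sum_(d in uncut C P) (pi - theta (edge_of d))).
Proof.
move=> hcut hP B0; have pi0 := pi_gt0 R.
rewrite sum_uncut//.
have := piece_euler hP; have := card_interior_cycles C P.
have := B0; rewrite -(boundary_components_gt0 hP).
set E := #|inner_edges C P|; set F := #|cycles_in (next T) P|.
set I := #|interior_cycles C P|; set W := #|cycles_in _ _|; set b := #|boundary_components C P|.
move=> b0 WE le2.
have Bpos : 0 < \sum_(d in boundary C P) theta (edge_of d).
  case/set0Pn: B0 => d dB; rewrite (bigD1 d)//=; case/andP: (htheta (edge_of d)) => t0 _.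
  by rewrite ltr_wpDr// sumr_ge0// => x _; case/andP: (htheta (edge_of x)) => /ltW.
have [/andP[/eqP W2 /eqP b1]|nd] := boolP ((W + F == E + 2)%N && (b == 1%N)).
  have hD : is_disc C P.
    by split=> //; rewrite /piece_has_genus -/W -/F -/E; lia.
  have [ge2 eq2] := hcut C P hP hD.
  have e : (I%:R : R) = E%:R - F%:R + 1.
    have : (I + F = E + 1)%N by lia.
    by move/(congr1 (fun n => n%:R : R)); rewrite !natrD => h; lra.
  rewrite e; split; first lra.
  move=> U0; suff : \sum_(d in boundary C P) theta (edge_of d) != 2 * pi.
    by move=> ne; have : 2 * pi < \sum_(d in boundary C P) theta (edge_of d);
      [rewrite lt_neqAle eq_sym ne|lra].
  apply/eqP => /[dup] S2 /eq2 /imsetP[x _ Px].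
  have := sum_piece_split C P (theta \o @edge_of T); rewrite {1}Px /= hsum S2.
  by have := sum_uncut_gt0 U0; lra.
have le : (I + F <= E)%N.
  move: nd; rewrite negb_and => /orP[] /eqP; lia.
have : (I%:R : R) + F%:R <= E%:R by rewrite -natrD ler_nat.
by move=> h; split; [|move=> _]; nra.
Qed.

(** The angles [psi] around the interior vertices of a piece sum to [pi] each, and
    altogether the uncut edges offer no more than [pi - theta] each.  By the Euler
    characteristic of a disc this gives the lower bound for its boundary.  Unless
    the disc is a single face without uncut edges, connectedness provides an uncut
    dart that does not belong to an interior vertex and makes the inequality strict. *)
Lemma angles_cut_condition (psi : dart T -> R) :
  (forall d, 0 < psi d) ->
  (forall d, psi d + psi (rev T d) <= pi - theta (edge_of d)) ->
  (forall C P O, is_piece C P -> O \in interior_cycles C P -> \sum_(d in O) psi d = pi) ->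
  cut_condition theta.
Proof.
move=> psi0 psi2 psiO C P hP [hg hb].
have B0 : boundary C P != finset.set0 by rewrite -(boundary_components_gt0 hP) hb.
pose W := [set d in P | [disjoint porbit (walk C) d & boundary C P]]%SET.
have WU : W \subset uncut C P.
  apply/fintype.subsetP => d; rewrite !inE => /andP[dP /pred0P/(_ d)].
  by rewrite /= porbit_id inE dP => /= /negbT.
have sumW : \sum_(d in W) psi d = pi * #|interior_cycles C P|%:R.
  rewrite mulr_natr -sumr_const.
  rewrite (partition_big (porbit (walk C)) (mem (interior_cycles C P))) /=; last first.
    move=> d; rewrite inE => /andP[dP dB]; rewrite inE dB andbT.
    by apply: porbit_in_cycles => // x; exact: (piece_walk hP).
  apply: eq_bigr => O OI; rewrite -(psiO C P O)//; apply: eq_bigl => d.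
  move: OI; rewrite inE => /andP[/mem_cycles_in[x xP ->] xB].
  rewrite eq_porbit_mem inE; case: (boolP (d \in porbit _ x)) => [dx|]; last by rewrite andbF.
  rewrite andbT; have /eqP -> : porbit (walk C) d == porbit (walk C) x by rewrite eq_porbit_mem.
  rewrite xB andbT; apply: fintype.subsetP dx; apply: porbit_sub xP => y.
  exact: (piece_walk hP).
have sumU : 2 * \sum_(d in uncut C P) psi d <= \sum_(d in uncut C P) (pi - theta (edge_of d)).
  have -> : 2 * \sum_(d in uncut C P) psi d = \sum_(d in uncut C P) (psi d + psi (rev T d)).
    rewrite big_split /= mulrDl mul1r; congr (_ + _).
    rewrite sum_rev; apply: eq_bigl => d; rewrite !inE edge_of_rev.
    case: (boolP (edge_of d \in C)) => dC; first by rewrite !andbF.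
    by rewrite (piece_rev hP).
  exact: ler_sum.
have sumWU : \sum_(d in uncut C P) psi d = \sum_(d in W) psi d +
    \sum_(d in uncut C P :\: W) psi d.
  rewrite (bigID (mem W)) /=; congr (_ + _); apply: eq_bigl => d.
    rewrite andbC; case: (boolP (d \in W)) => //= dW.
    by rewrite (fintype.subsetP WU).
  by rewrite finset.in_setD andbC.
have D0 : 0 <= \sum_(d in uncut C P :\: W) psi d by apply: sumr_ge0 => d _; exact: ltW.
(* if all uncut darts belonged to interior vertices, they would fill the piece *)
have lt : uncut C P != finset.set0 -> 0 < \sum_(d in uncut C P :\: W) psi d.
  move=> U0; have /set0Pn[d dD] : uncut C P :\: W != finset.set0.
    apply: contra B0; rewrite finset.setD_eq0 => UW.
    have eUW d : (d \in W) = (d \in uncut C P).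
      by apply/idP/idP; apply: fintype.subsetP.
    have rW d : d \in W -> rev T d \in W.
      rewrite !eUW !inE edge_of_rev => /andP[dP dC].
      by rewrite (piece_rev hP)// dP.
    have uW d : d \in W -> edge_of d \notin C by rewrite eUW inE => /andP[].
    have PW : P \subset W.
      apply: (piece_connected hP).
      - by case/set0Pn: U0 => d dU; exists d; rewrite ?eUW//; move: dU; rewrite inE => /andP[].
      - move=> d dW; have := rW d dW; rewrite [in X in X -> _]inE => /andP[rP rB].
        have -> : next T d = walk C (rev T d).
          by rewrite walkE crossE edge_of_rev (negbTE (uW _ dW)) revK.
        by rewrite inE (piece_walk hP)//= porbit_image.
      - by move=> d dW; rewrite crossE (negbTE (uW d dW)) rW.
    apply/eqP/setP => d; rewrite !inE; apply/negbTE/negP => /andP[dP].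
    by apply/negP/uW/(fintype.subsetP PW).
  rewrite (bigD1 d)//= ltr_wpDr//; apply: sumr_ge0 => x _; exact: ltW.
have e : (#|interior_cycles C P|%:R : R) =
    1 + #|inner_edges C P|%:R - #|cycles_in (next T) P|%:R.
  move: hg; rewrite /piece_has_genus -/(inner_edges C P) card_interior_cycles hb => hg.
  have count (i k f : nat) : (i + 1)%N%:Z - k%:Z + f%:Z = 2 - 2 * 0%:Z -> (i + f = k + 1)%N.
    by clear; lia.
  by have /count := hg; move/(congr1 (fun n => n%:R : R)); rewrite !natrD => h; lra.
have := sum_uncut hP; move: sumW sumU; rewrite e.
set B := \sum_(d in boundary C P) _ => sumW sumU sU.
split; first by lra.
have [U0|U0] := eqVneq (uncut C P) finset.set0.
  have h1 := uncut_eq0 hP U0; split=> // _.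
  have := sum_piece_split C P (theta \o @edge_of T); rewrite /= -/B U0 finset.big_set0 addr0 => <-.
  by case/imsetP: h1 => x _ ->; exact: hsum.
have := lt U0; split=> [|h1]; first lra.
have := sum_piece_split C P (theta \o @edge_of T); rewrite /= -/B.
have -> : \sum_(d in P) theta (edge_of d) = 2 * pi by case/imsetP: h1 => x _ ->; exact: hsum.
by have := sum_uncut_gt0 U0; lra.
Qed.

End CutCondition.

(** * The cut condition and kite angles *)

Section Dual.
Variable S : cellular_surface.
Notation D := (dual S).
Implicit Types (C : {set edge D}) (d y z : dart S).

Lemma dual_walk C z : edge_of z \notin C ->
  walk C (rev S z : dart D) = rev S ((next S)^-1%g z).
Proof.
move=> zC; rewrite walkE crossE (edge_of_rev (T := D)) (negbTE zC) next_dual.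
by rewrite /= !revK /next invMg invgK permM (_ : (rev S)^-1%g = rev S) ?revK//;
   apply/permP => x; rewrite -{1}[x](@revK S) permK.
Qed.

(** The vertices of the dual in the interior of a piece are the faces of the
    surface all of whose edges are uncut. *)
Lemma dual_interior C y :
  (forall d, d \in porbit (next S) (rev S y) -> edge_of d \notin C) \/
  (forall d, d \in porbit (walk C) (y : dart D) -> edge_of d \notin C) ->
  forall d, (d \in porbit (walk C) (y : dart D)) = (rev S d \in porbit (next S) (rev S y)).
Proof.
move=> h; have E n : (walk C ^+ n)%g (y : dart D) = rev S (((next S)^-1 ^+ n)%g (rev S y)).
  elim: n => [|n IH]; first by rewrite !expg0 !perm1 revK.
  rewrite [in LHS]expgSr (permM (walk C ^+ n)%g) IH expgSr [in RHS]permM; apply: dual_walk.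
  case: h => [|/(_ (rev S (((next S)^-1 ^+ n)%g (rev S y))))].
    by apply; rewrite -porbitV mem_porbit.
  by rewrite -IH mem_porbit IH (edge_of_rev (T := S)) => /(_ isT).
move=> d; rewrite -[in RHS]porbitV; apply/porbitP/porbitP => -[n].
  by rewrite E => ->; exists n; rewrite revK.
by move=> e; exists n; rewrite E -e revK.
Qed.

Lemma sum_interior_cycle (R : realType) C P (phi : dart S -> R) O :
  O \in interior_cycles (T := D) C P -> exists f : face S,
    \sum_(d in O) phi (rev S d) = \sum_(d in val f) phi d.
Proof.
rewrite inE => /andP[/[dup] /mem_cycles_in[y _ eO]].
rewrite inE => /andP[_ OP] OB.
exists (left_face (rev S y)); rewrite [RHS]sum_rev; apply: eq_bigl => d.
rewrite eO; apply: dual_interior; right => x xy.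
have /pred0P/(_ x) := OB; rewrite /= eO xy /= inE.
by rewrite (fintype.subsetP OP) ?eO// => /negbT.
Qed.

Variables (R : realType) (theta : edge S -> R).
Hypothesis htheta : forall e, 0 < theta e < pi.
Hypothesis hsum : forall v : vertex S, \sum_(d in val v) theta (edge_of d) = 2 * pi.

Lemma dual_face_sum x :
  \sum_(d in porbit (next D) x) (theta : edge D -> R) (edge_of (d : dart D)) = 2 * pi.
Proof. by rewrite next_dual; exact: (hsum (cycle_of (rot S) x)). Qed.

(** Cut the dual along the edges that do not meet [F']: the vertices of the dual
    belonging to [F'] become interior vertices of the pieces.  Since some edge is
    cut, every piece has a boundary, and [cut_condition_piece] can be summed over
    the pieces. *)
Lemma hall_of_boundary (F' : {set face S}) :
  cut_condition (theta : edge D -> R) ->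
  F' != finset.set0 -> (exists d, ~~ incident F' d) ->
  2 * pi * #|F'|%:R < \sum_(d | incident F' d) (pi - theta (edge_of d)).
Proof.
move=> hcut F'0 [d0 d0F].
pose C : {set edge D} := [set e : edge D | [forall d : dart S, (d \in val e) ==> ~~ incident F' d]]%SET.
have CE (d : dart S) : ((edge_of d : edge D) \in C) = ~~ incident F' d.
  rewrite inE; apply/forallP/idP => [/(_ d)|h x]; first by rewrite /= porbit_id.
  apply/implyP; rewrite (mem_edge (T := D)) (edge_of_eq (T := D)) => /orP[]/eqP-> //.
  by rewrite /incident revK orbC.
pose pieces : {set {set dart D}} := [set piece_of C x | x in [set: dart D]%SET]%SET.
have hP P : P \in pieces -> is_piece C P by case/imsetP => x _ ->; exact: piece_of_is_piece.
have bP P : P \in pieces -> boundary C P != finset.set0.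
  move=> /hP PP; apply/negP => /eqP/(boundary_eq0 PP)[_ C0].
  by have := finset.in_set0 (edge_of d0 : edge D); rewrite -C0 CE d0F.
have -> : \sum_(d | incident F' d) (pi - theta (edge_of d)) =
    \sum_(P in pieces) \sum_(d in uncut C P) (pi - theta (edge_of d)).
  rewrite (partition_big (piece_of C) (mem pieces)) /=; last by move=> d _; exact: imset_f.
  apply: eq_bigr => P /imsetP[x _ ->]; apply: eq_bigl => d.
  by rewrite inE mem_piece_of CE negbK andbC.
pose INT := \bigcup_(P in pieces) interior_cycles C P.
have mem_INT (f : face S) : f \in F' -> [set rev S d | d in val f]%SET \in INT.
  move=> fF; have [x xf] := face_surj f.
  have E d : (d \in porbit (walk C) (rev S x : dart D)) = (rev S d \in val f).
    rewrite dual_interior ?revK -?xf//; left => y yf; rewrite CE negbK /incident.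
    by move: yf; rewrite -[porbit _ _]/(val (left_face x)) xf mem_face => /eqP->; rewrite fF.
  have -> : [set rev S d | d in val f]%SET = porbit (walk C) (rev S x : dart D).
    apply/setP => y; rewrite E; apply/imsetP/idP => [[d df ->]|h]; first by rewrite revK.
    by exists (rev S y); rewrite ?revK.
  have PP : is_piece C (piece_of C (rev S x : dart D)) by exact: piece_of_is_piece.
  apply/bigcupP; exists (piece_of C (rev S x : dart D)); first exact: imset_f.
  rewrite inE porbit_in_cycles; [|by move=> z; exact: (piece_walk PP)|exact: piece_of_refl].
  apply/pred0P => d; apply/negbTE; rewrite /= E inE CE !negb_and negbK.
  case: (boolP (rev S d \in val f)) => //=.
  by rewrite mem_face /incident => /eqP->; rewrite fF !orbT.
have card_INT : (#|F'| <= \sum_(P in pieces) #|interior_cycles C P|)%N.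
  have injf : {in F' &, injective (fun f : face S => [set rev S d | d in val f]%SET)}.
    by move=> f f' _ _ /imset_inj h; apply/val_inj/h; exact: perm_inj.
  rewrite -(card_in_imset injf).
  apply: (@leq_trans #|INT|).
    by apply: subset_leq_card; apply/fintype.subsetP => _ /imsetP[f fF ->]; exact: mem_INT.
  rewrite /INT; elim/big_rec2: _ => [|P n A _ IH]; first by rewrite cards0.
  by apply: leq_trans (leq_card_setU _ _) _; rewrite leq_add2l.
have [f fF] := set0Pn _ F'0; have [x xf] := face_surj f.
have xP : piece_of C (x : dart D) \in pieces by exact: imset_f.
have cp P (PP : P \in pieces) :=
  cut_condition_piece (theta := (theta : edge D -> R)) htheta dual_face_sum hcut
    (hP P PP) (bP P PP).
apply: (@le_lt_trans _ _ (\sum_(P in pieces) 2 * pi * #|interior_cycles C P|%:R)).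
  rewrite -mulr_sumr ler_pM2l ?mulr_gt0 ?pi_gt0// -natr_sum ler_nat.
  exact: card_INT.
rewrite (bigD1 _ xP) [X in _ < X](bigD1 _ xP) /=; apply: ltr_leD.
  apply: (cp _ xP).2; apply/set0Pn; exists x.
  by rewrite inE piece_of_refl CE negbK /incident xf fF.
by apply: ler_sum => P /andP[PP _]; exact: (cp _ PP).1.
Qed.

Lemma cut_condition_of_angles (phi : dart S -> R) :
  (forall d, 0 < phi d) ->
  (forall d, phi d + phi (rev S d) <= pi - theta (edge_of d)) ->
  (forall f : face S, \sum_(d in val f) phi d = pi) ->
  cut_condition (theta : edge D -> R).
Proof.
move=> phi0 phi2 phif.
apply: (angles_cut_condition (T := D) htheta dual_face_sum (psi := fun d => phi (rev S d))).
- by [].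
- by move=> d; rewrite /= revK addrC.
- by move=> C P O hP /(sum_interior_cycle phi)[f ->].
Qed.

(** The Gauss-Bonnet formula for the angles that all kites offer. *)
Lemma sum_angle_defects g : has_genus S g ->
  \sum_d (pi - theta (edge_of d)) = 2 * pi * (#|{: face S}|%:R + 2 * g%:R - 2).
Proof.
rewrite /has_genus => hg.
have hV : \sum_d theta (edge_of d) = 2 * pi * #|{: vertex S}|%:R.
  rewrite (partition_big (cycle_of (rot S)) predT) //= mulr_natr -sumr_const.
  by apply: eq_bigr => v _; rewrite -(hsum v); apply: eq_bigl => d; rewrite mem_cycle_of.
have hE : #|dart S| = (2 * #|{: edge S}|)%N.
  rewrite -sum1_card (partition_big (@edge_of S) predT) //= mulnC -sum_nat_const.
  apply: eq_bigr => e _; have [d <-] := edge_surj e; rewrite sum1_card.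
  rewrite -[RHS](_ : #|[set d; rev S d]%SET| = 2%N); last by rewrite cards2 eq_sym rev_neq.
  by apply: eq_card => y; rewrite [LHS]unfold_in -[LHS]/(edge_of y == edge_of d) edge_of_eq !inE.
rewrite sumrB hV sumr_const hE -[pi *+ _]mulr_natr natrM.
have : (#|{: vertex S}|%:R : R) - #|{: edge S}|%:R + #|{: face S}|%:R = 2 - 2 * g%:R.
  have := congr1 (intr : int -> R) hg; by rewrite intrD !intrB intrM.
move=> h; rewrite (_ : _ + _ - 2 = #|{: edge S}|%:R - #|{: vertex S}|%:R); first ring.
by lra.
Qed.

End Dual.

(** * Kites in the model planes *)

Section Plane.
Variable R : realType.
Implicit Types (G : geometry) (x y z p q e : 'rV[R]_3) (u v r th : R).

Lemma dotC G x y : dot G x y = dot G y x.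
Proof. by case: G; rewrite /dot; ring. Qed.

Lemma dotDl G x y z : dot G (x + y) z = dot G x z + dot G y z.
Proof. by case: G; rewrite /dot !mxE; ring. Qed.

Lemma dotZl G a x z : dot G (a *: x) z = a * dot G x z.
Proof. by case: G; rewrite /dot !mxE; ring. Qed.

Lemma dotDr G x y z : dot G z (x + y) = dot G z x + dot G z y.
Proof. by rewrite dotC dotDl !(dotC _ z). Qed.

Lemma dotZr G a x z : dot G z (a *: x) = a * dot G z x.
Proof. by rewrite dotC dotZl (dotC _ z). Qed.

Lemma dotBl G x y z : dot G (x - y) z = dot G x z - dot G y z.
Proof. by rewrite -scaleN1r dotDl dotZl mulN1r. Qed.

Lemma dotBr G x y z : dot G z (x - y) = dot G z x - dot G z y.
Proof. by rewrite dotC dotBl !(dotC _ z). Qed.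

(** A positive value of [acos] is not the default value taken outside of its
    domain, so the argument is a cosine. *)
Lemma acos_eq t th : acos t = th -> 0 < th -> t = cos th.
Proof.
rewrite acos.unlock; case: xgetP => [y _ [_ <-] -> //|_ <-].
by rewrite ltxx.
Qed.

(** The hyperbolic cosine and sine of [r], where [u] is [tanh (r / 2)]. *)
Definition cosh_half u : R := (1 + u ^+ 2) / (1 - u ^+ 2).
Definition sinh_half u : R := 2 * u / (1 - u ^+ 2).

Lemma cosh_half2 u : 0 < u < 1 -> cosh_half u ^+ 2 = 1 + sinh_half u ^+ 2.
Proof. by move=> h; rewrite /cosh_half /sinh_half; field; apply/lt0r_neq0; nra. Qed.

(** The parameter [r] or [tanh (r / 2)] of a circle, and its inverse. *)
Definition radius_param G r : R :=
  if G is Hyperbolic then (expR r - 1) / (expR r + 1) else r.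

Definition param_radius G u : R :=
  if G is Hyperbolic then ln ((1 + u) / (1 - u)) else u.

Lemma radius_param_domain G r : 0 < r -> radius_domain G (radius_param G r).
Proof.
move=> r0; case: G => //=; have e0 := expR_gt0 r; have e1 : 1 < expR r by rewrite expR_gt1.
split; first by rewrite divr_gt0//; lra.
by rewrite ltr_pdivrMr; lra.
Qed.

Lemma param_radius_gt0 G u : radius_domain G u -> 0 < param_radius G u.
Proof.
case: G => -[u0 u1] //=; apply: ln_gt0; rewrite ltr_pdivlMr; lra.
Qed.

Lemma param_radiusK G u : radius_domain G u -> radius_param G (param_radius G u) = u.
Proof.
case: G => -[u0 u1] //=; rewrite lnK; last by rewrite posrE divr_gt0//; lra.
by field; apply/andP; split; apply: lt0r_neq0; lra.
Qed.

Lemma radius_paramK G r : param_radius G (radius_param G r) = r.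
Proof.
case: G => //=; have e0 := expR_gt0 r.
rewrite (_ : _ / _ = expR r) ?expRK//.
by field; rewrite (_ : _ - _ = 2) ?pnatr_eq0 ?andbT; [apply: lt0r_neq0; lra|ring].
Qed.

(** The squared distance or the hyperbolic cosine of the distance: a function of
    the distance that is polynomial in the coordinates. *)
Definition separation G x y : R :=
  if G is Hyperbolic then - dot Hyperbolic x y else dot Euclidean (x - y) (x - y).

Definition separation_at G u : R := if G is Hyperbolic then cosh_half u else u ^+ 2.

Lemma separationC G x y : separation G x y = separation G y x.
Proof.
by case: G; rewrite /separation; [rewrite -opprB -scaleN1r dotZl dotZr; ring|rewrite dotC].
Qed.

Lemma dist_separation G x y r : dist G x y = r -> 0 < r ->
  separation G x y = separation_at G (radius_param G r).
Proof.
case: G; last first.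
  rewrite /dist /separation /separation_at.
  set t := - dot _ _ _; rewrite /arcosh => er r0.
  set w := t + Num.sqrt _ in er.
  have w0 : 0 < w.
    rewrite ltNge; apply/negP => w0; move: r0; rewrite -er ln0 ?ltxx//.
  have we : w = expR r by rewrite -er lnK.
  have e1 : 1 < expR r by rewrite expR_gt1.
  have [t1|t1] := lerP 0 (t ^+ 2 - 1); last first.
    have wt : w = t by rewrite /w ltr0_sqrtr ?addr0.
    by move: e1; rewrite -we wt => e1; nra.
  have : (w - t) ^+ 2 = t ^+ 2 - 1 by rewrite /w addrAC subrr add0r sqr_sqrtr.
  rewrite we => h; rewrite /cosh_half /=; set ex := expR r in e1 h *.
  apply: (@mulfI _ (2 * ex)); first by apply: lt0r_neq0; lra.
  transitivity (ex ^+ 2 + 1); first by nra.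
  by field; apply/andP; split; apply: lt0r_neq0; nra.
rewrite /separation /= => er r0; rewrite -er sqr_sqrtr//.
by rewrite addr_ge0// -expr2 sqr_ge0.
Qed.

Lemma separation_dist G x y u : radius_domain G u ->
  separation G x y = separation_at G u -> dist G x y = param_radius G u.
Proof.
case: G => -[u0 u1] /= ->; first by rewrite sqrtr_sqr gtr0_norm.
rewrite /arcosh; congr ln.
rewrite cosh_half2 ?u0// addrAC subrr add0r sqrtr_sqr gtr0_norm; last first.
  by rewrite /sinh_half divr_gt0//; nra.
rewrite /cosh_half /sinh_half; field; apply/andP; split; apply: lt0r_neq0; nra.
Qed.

Lemma sinh_half_gt0 u : radius_domain Hyperbolic u -> 0 < sinh_half u.
Proof. by case=> u0 u1; rewrite /sinh_half divr_gt0//; nra. Qed.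

(** The inner product of the directions from [p] to [a] and [b], computed from the
    three separations. *)
Definition law_of_cosines G (spa spb sab : R) : R :=
  if G is Hyperbolic then spa * spb - sab else (spa + spb - sab) / 2.

Lemma dot_direction G p x y : in_plane G p ->
  dot G (direction G p x) (direction G p y) =
  law_of_cosines G (separation G p x) (separation G p y) (separation G x y).
Proof.
case: G => [_|[pp _]]; first by rewrite /= !mxE; field.
rewrite /separation /law_of_cosines /direction !dotDl !dotDr !dotZl !dotZr pp.
rewrite (dotC _ x p); ring.
Qed.

Lemma separation_self G x : in_plane G x ->
  separation G x x = if G is Hyperbolic then 1 else 0.
Proof.
by case: G => [_|[xx _]]; rewrite /separation ?xx ?opprK// subrr /dot !mxE; ring.
Qed.

Definition opposite_separation G th u v : R :=
  if G is Hyperbolic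
  then cosh_half u * cosh_half v - sinh_half u * sinh_half v * cos th
  else u ^+ 2 + v ^+ 2 - 2 * u * v * cos th.

Lemma opposite_separationC G th u v :
  opposite_separation G th u v = opposite_separation G th v u.
Proof. by case: G; rewrite /opposite_separation; ring. Qed.

(** Half of a kite: the triangle with the centres [p], [q] and the intersection
    point [e], determined by two sides and the enclosed angle [th]. *)
Definition kite_triangle G th u v p q e : Prop :=
  [/\ in_plane G p, in_plane G q & in_plane G e] /\
  [/\ separation G p e = separation_at G u, separation G q e = separation_at G v &
      separation G p q = opposite_separation G th u v].

Lemma kite_triangleC G th u v p q e :
  kite_triangle G th u v p q e -> kite_triangle G th v u q p e.
Proof.
by case=> -[? ? ?] [? ? ?]; split; split; rewrite // separationC opposite_separationC.
Qed.

Lemma law_at_endpoint G th u v : radius_domain G u -> radius_domain G v ->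
  law_of_cosines G (separation_at G u) (separation_at G v) (opposite_separation G th u v) /
   (Num.sqrt (law_of_cosines G (separation_at G u) (separation_at G u)
      (if G is Hyperbolic then 1 else 0)) *
    Num.sqrt (law_of_cosines G (separation_at G v) (separation_at G v)
      (if G is Hyperbolic then 1 else 0))) = cos th.
Proof.
case: G => - [u0 u1] [v0 v1] /=.
  have e w : (w ^+ 2 + w ^+ 2 - 0) / 2 = w ^+ 2 :> R by field.
  rewrite !e !sqrtr_sqr !gtr0_norm//; field; by rewrite !gt_eqF.
have e w : 0 < w < 1 -> cosh_half w * cosh_half w - 1 = sinh_half w ^+ 2.
  by move=> h; rewrite -expr2 cosh_half2// addrAC subrr add0r.
have su := sinh_half_gt0 (conj u0 u1); have sv := sinh_half_gt0 (conj v0 v1).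
rewrite !e ?u0 ?v0// !sqrtr_sqr !gtr0_norm//; field; by rewrite !gt_eqF.
Qed.

Lemma law_of_cosines_inj G a b s s' :
  law_of_cosines G a b s = law_of_cosines G a b s' -> s = s'.
Proof. by case: G => /=; lra. Qed.

Lemma triangle_of_angle G th r r' p q e : 0 < th -> 0 < r -> 0 < r' ->
  in_plane G p -> in_plane G q -> in_plane G e ->
  dist G p e = r -> dist G q e = r' -> angle G e p q = th ->
  kite_triangle G th (radius_param G r) (radius_param G r') p q e.
Proof.
move=> th0 r0 r'0 pP qP eP pe qe /acos_eq/(_ th0).
have hu := radius_param_domain G r0; have hv := radius_param_domain G r'0.
have spe := dist_separation pe r0; have sqe := dist_separation qe r'0.
rewrite !dot_direction// ![separation G e _]separationC spe sqe !separation_self//.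
rewrite -[in RHS](law_at_endpoint th hu hv) => h; split=> //; split=> //.
apply: (@law_of_cosines_inj G _ _ _ _); move/mulIf: h; apply.
rewrite invr_eq0; case: (G) hu hv => - [u0 u1] [v0 v1].
  by apply: lt0r_neq0; rewrite mulr_gt0// sqrtr_gt0 /=; nra.
by apply: lt0r_neq0; rewrite mulr_gt0// sqrtr_gt0 /= -expr2 cosh_half2 ?u0 ?v0//;
   rewrite addrAC subrr add0r exprn_gt0// sinh_half_gt0.
Qed.

Lemma angle_at_endpoint G th u v p q e : 0 < th < pi ->
  radius_domain G u -> radius_domain G v -> kite_triangle G th u v p q e ->
  angle G e p q = th.
Proof.
move=> /andP[t0 t1] hu hv [[pP qP eP] [pe qe pq]].
rewrite /angle !dot_direction// ![separation G e _]separationC pe qe pq !separation_self//.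
by rewrite law_at_endpoint// cosK// in_itv /= !ltW.
Qed.

(** Normalizing the direction vector [(N, M)] of the angle [a]. *)
Lemma ratio_cos (a m N M : R) : 0 < m -> sin a = m * M -> cos a = m * N ->
  N / Num.sqrt (N ^+ 2 + M ^+ 2) = cos a.
Proof.
move=> m0 sE cE; have := cos2Dsin2 a; rewrite sE cE => h.
have -> : N ^+ 2 + M ^+ 2 = (m^-1) ^+ 2.
  by rewrite exprVn -[RHS]mul1r -h; field; rewrite gt_eqF.
by rewrite sqrtr_sqr gtr0_norm ?invr_gt0// invrK mulrC.
Qed.

Lemma angle_at_center G th u v p q e : 0 < th < pi ->
  radius_domain G u -> radius_domain G v -> kite_triangle G th u v p q e ->
  angle G p e q = center_half_angle G th u v.
Proof.
move=> hth hu hv [[pP qP eP] [pe qe pq]].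
have [m m0 [sE cE]] := center_half_angle_trig hth hu hv.
have hr := ratio_cos m0 sE cE.
rewrite /angle !dot_direction// [separation G e q]separationC pe qe pq !separation_self//.
rewrite (_ : _ / _ = cos (center_half_angle G th u v)).
  by rewrite cosK// in_itv /= !ltW ?center_half_angle_gt0// center_half_angle_ltpi.
rewrite -hr; have cs := cos2Dsin2 th.
have s2 : sin th ^+ 2 = 1 - cos th ^+ 2 by rewrite -cs; ring.
case: G hu hv {pP qP eP pe qe pq m m0 sE cE hr} => - [u0 u1] [v0 v1] /=.
  have -> : (u ^+ 2 + u ^+ 2 - 0) / 2 = u ^+ 2 by field.
  set L := u ^+ 2 + v ^+ 2 - _.
  have -> : (L + L - 0) / 2 = (u - v * cos th) ^+ 2 + (v * sin th) ^+ 2.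
    by rewrite exprMn s2 /L; field.
  have -> : (u ^+ 2 + L - v ^+ 2) / 2 = u * (u - v * cos th) by rewrite /L; field.
  by rewrite sqrtr_sqr gtr0_norm// -mulf_div divff ?gt_eqF// mul1r.
have hu : 0 < u < 1 by rewrite u0. have hv : 0 < v < 1 by rewrite v0.
have -> : cosh_half u * cosh_half u - 1 = sinh_half u ^+ 2.
  by rewrite -expr2 cosh_half2// addrAC subrr add0r.
have su := sinh_half_gt0 (conj u0 u1).
set L := cosh_half u * cosh_half v - _.
pose k := (1 - u ^+ 2) * (1 - v ^+ 2) / 2.
have u2 : 0 < 1 - u ^+ 2 by nra. have v2 : 0 < 1 - v ^+ 2 by nra.
have k0 : 0 < k by rewrite divr_gt0// mulr_gt0.
have -> : cosh_half u * L - cosh_half v = sinh_half u *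
   ((u * (1 + v ^+ 2) - v * (1 + u ^+ 2) * cos th) / k).
  by rewrite /L /k /cosh_half /sinh_half; field; rewrite !gt_eqF.
have -> : L * L - 1 = ((u * (1 + v ^+ 2) - v * (1 + u ^+ 2) * cos th) ^+ 2 +
    (v * (1 - u ^+ 2) * sin th) ^+ 2) * (k^-1) ^+ 2.
  rewrite [(_ * sin th) ^+ 2]exprMn s2 /L /k /cosh_half /sinh_half.
  by field; rewrite !gt_eqF.
rewrite [Num.sqrt (_ * k^-1 ^+ 2)]sqrtrM; last by rewrite addr_ge0// sqr_ge0.
rewrite !sqrtr_sqr (gtr0_norm su) (gtr0_norm (_ : 0 < k^-1)) ?invr_gt0//.
rewrite -mulf_div divff ?gt_eqF// mul1r; clearbody k.
set X := Num.sqrt _; rewrite invfM invrK; move: X^-1 => i; field.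
by rewrite gt_eqF.
Qed.

End Plane.

Section Kites.
Variable R : realType.
Implicit Types (G : geometry) (p q e x y : 'rV[R]_3) (u v th : R).

Definition kite_points G th u v p q e e' : Prop :=
  [/\ kite_triangle G th u v p q e, kite_triangle G th u v p q e' & e != e'].

Definition vec3 (a b c : R) : 'rV[R]_3 := \row_j nth 0 [:: a; b; c] j.

Lemma vec3E a b c : ((vec3 a b c 0 0 = a) * (vec3 a b c 0 1 = b) * (vec3 a b c 0 2 = c))%type.
Proof. by rewrite /vec3 !mxE. Qed.

(** The squared hyperbolic sine of the distance of the two centres, as a sum of
    squares. *)
Lemma hyperbolic_opposite_square th u v : 0 < th < pi ->
  radius_domain Hyperbolic u -> radius_domain Hyperbolic v ->
  opposite_separation Hyperbolic th u v ^+ 2 - 1 =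
    (cosh_half v * sinh_half u - cosh_half u * sinh_half v * cos th) ^+ 2 +
    (sinh_half v * sin th) ^+ 2 /\ 0 < opposite_separation Hyperbolic th u v ^+ 2 - 1.
Proof.
move=> hth hu hv; have s2 : sin th ^+ 2 = 1 - cos th ^+ 2 by rewrite -(cos2Dsin2 th); ring.
have E : opposite_separation Hyperbolic th u v ^+ 2 - 1 =
    (cosh_half v * sinh_half u - cosh_half u * sinh_half v * cos th) ^+ 2 +
    (sinh_half v * sin th) ^+ 2.
  case: hu hv => u0 u1 [v0 v1].
  rewrite [(_ * sin th) ^+ 2]exprMn s2 /opposite_separation /cosh_half /sinh_half.
  by field; apply/andP; split; apply: lt0r_neq0; nra.
split=> //; rewrite E ltr_wpDl ?sqr_ge0// exprn_gt0// mulr_gt0 ?sin_gt0_of//.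
exact: sinh_half_gt0.
Qed.

Lemma euclidean_opposite_square th u v : 0 < th < pi -> 0 < v ->
  opposite_separation Euclidean th u v = (u - v * cos th) ^+ 2 + (v * sin th) ^+ 2 /\
  0 < opposite_separation Euclidean th u v.
Proof.
move=> hth v0; have s2 : sin th ^+ 2 = 1 - cos th ^+ 2 by rewrite -(cos2Dsin2 th); ring.
have E : opposite_separation Euclidean th u v = (u - v * cos th) ^+ 2 + (v * sin th) ^+ 2.
  by rewrite exprMn s2 /opposite_separation; ring.
by split=> //; rewrite E ltr_wpDl ?sqr_ge0// exprn_gt0// mulr_gt0 ?sin_gt0_of.
Qed.

Lemma cosh_half_gt1 u : radius_domain Hyperbolic u -> 1 < cosh_half u.
Proof. by case=> u0 u1; rewrite /cosh_half ltr_pdivlMr; nra. Qed.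

(** Place the first centre at the base point, the second one on the first axis and
    the two intersection points symmetrically with respect to this axis. *)
Lemma kite_exists G th u v : 0 < th < pi -> radius_domain G u -> radius_domain G v ->
  exists p q e e', kite_points G th u v p q e e'.
Proof.
move=> hth hu hv; have s0 := sin_gt0_of hth; case: G hu hv => hu hv.
{ case: hu hv => u0 _ [v0 _].
  have [L2 L2pos] := euclidean_opposite_square u hth v0.
  set L2' := opposite_separation _ _ _ _ in L2 L2pos.
  set L := Num.sqrt L2'; have L0 : 0 < L by rewrite sqrtr_gt0.
  have LL : L ^+ 2 = L2' by rewrite sqr_sqrtr// ltW.
  set x := u * (u - v * cos th) / L; set y := u * v * sin th / L.
  have y0 : 0 < y by rewrite divr_gt0// mulr_gt0// mulr_gt0.
  have xy : x ^+ 2 + y ^+ 2 = u ^+ 2.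
    apply: (@mulIf _ (L ^+ 2)); first by rewrite gt_eqF// exprn_gt0.
    by rewrite [in RHS]LL L2 /x /y; field; rewrite gt_eqF.
  have xL : x * L = u * (u - v * cos th) by rewrite /x divfK// gt_eqF.
  have L2E : L ^+ 2 = u ^+ 2 + v ^+ 2 - 2 * u * v * cos th by rewrite LL.
  exists (vec3 1 0 0), (vec3 1 L 0), (vec3 1 x y), (vec3 1 x (- y)).
  split; last first.
    by apply/eqP => /rowP/(_ 2); rewrite !vec3E => yy; move: y0; lra.
  all: split; split; rewrite /in_plane /separation /dot ?mxE ?vec3E //=.
  - by rewrite -xy; ring.
  - by transitivity (L ^+ 2 - 2 * (x * L) + (x ^+ 2 + y ^+ 2)); [ring|rewrite xL xy L2E; ring].
  - by rewrite -L2E; ring.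
  - by rewrite -xy; ring.
  - by transitivity (L ^+ 2 - 2 * (x * L) + (x ^+ 2 + y ^+ 2)); [ring|rewrite xL xy L2E; ring].
  - by rewrite -L2E; ring. }
have [L2 L2pos] := hyperbolic_opposite_square hth hu hv.
have cu1 := cosh_half_gt1 hu; have cv1 := cosh_half_gt1 hv.
have su := sinh_half_gt0 hu; have sv := sinh_half_gt0 hv.
have hu' : 0 < u < 1 by case: hu => -> ->.
have hv' : 0 < v < 1 by case: hv => -> ->.
have cu2 := cosh_half2 hu'; have cv2 := cosh_half2 hv'.
set L := opposite_separation _ _ _ _ in L2 L2pos.
have LE : L = cosh_half u * cosh_half v - sinh_half u * sinh_half v * cos th by [].
have L0 : 0 < L.
  have c1 : cos th <= 1 by exact: cos_le1.
  rewrite LE; have := cu2; have := cv2; move: cu1 cv1 su sv c1.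
  move: (cosh_half u) (cosh_half v) (sinh_half u) (sinh_half v) (cos th) => a b c d k.
  move=> a1 b1 c0 d0 k1 b2 a2; have ca : c < a by nra.
  have db : d < b by nra.
  have : c * d < a * b by nra.
  have : c * d * k <= c * d by rewrite ler_piMr// ltW// mulr_gt0.
  lra.
set D := Num.sqrt (L ^+ 2 - 1); have D0 : 0 < D by rewrite sqrtr_gt0.
have DD : D ^+ 2 = L ^+ 2 - 1 by rewrite sqr_sqrtr// ltW.
set N := cosh_half v * sinh_half u - cosh_half u * sinh_half v * cos th in L2.
set x := sinh_half u * N / D; set y := sinh_half u * (sinh_half v * sin th) / D.
have y0 : 0 < y by rewrite divr_gt0// mulr_gt0// mulr_gt0.
have xy : x ^+ 2 + y ^+ 2 = sinh_half u ^+ 2.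
  apply: (@mulIf _ (D ^+ 2)); first by rewrite gt_eqF// exprn_gt0.
  by rewrite [in RHS]DD L2 /x /y; field; rewrite gt_eqF.
have xD : x * D = sinh_half u * N by rewrite /x divfK// gt_eqF.
have xq : cosh_half u * L - x * D = cosh_half v.
  rewrite xD LE /N.
  transitivity (cosh_half v * (cosh_half u ^+ 2 - sinh_half u ^+ 2)); first ring.
  by rewrite cu2; ring.
exists (vec3 1 0 0), (vec3 L D 0), (vec3 (cosh_half u) x y), (vec3 (cosh_half u) x (- y)).
split; last first.
  by apply/eqP => /rowP/(_ 2); rewrite !vec3E => yy; move: y0; lra.
all: split; split; rewrite /in_plane /separation /dot /separation_at ?vec3E //=.
all: try (split; last by lra).
all: try (by rewrite -LE; ring).
all: try (by rewrite -xq; ring).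
all: try ring.
- by rewrite -!expr2 DD; ring.
- by rewrite mulrNN -!expr2 xy cu2; ring.
- by rewrite -!expr2 DD; ring.
- by rewrite -!expr2 xy cu2; ring.
Qed.

End Kites.

Section Congruence.
Variable R : realType.
Implicit Types (G : geometry) (p q e x y : 'rV[R]_3) (u v th : R).

Lemma dot_square_sub G x y : dot G (x - y) (x - y) = dot G x x - 2 * dot G y x + dot G y y.
Proof. by rewrite dotBl !dotBr (dotC _ x y); ring. Qed.

Definition frame p q e : 'M[R]_3 := \matrix_i nth 0 [:: p; q; e] i.

Lemma mul_frame (z : 'rV[R]_3) p q e :
  z *m frame p q e = z 0 0 *: p + z 0 1 *: q + z 0 2 *: e.
Proof.
have i1 : lift ord0 ord0 = 1 :> 'I_3 by exact: val_inj.
have i2 : lift ord0 (lift ord0 ord0) = 2 :> 'I_3 by exact: val_inj.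
by rewrite mulmx_sum_row !big_ord_recl big_ord0 addr0 !rowK /= addrA i1 i2.
Qed.

Lemma frame_rows p q e : exists z1 z2 z3 : 'rV[R]_3,
  forall p' q' e', [/\ z1 *m frame p' q' e' = p', z2 *m frame p' q' e' = q' &
    z3 *m frame p' q' e' = e'].
Proof.
exists (vec3 1 0 0), (vec3 0 1 0), (vec3 0 0 1) => p' q' e'.
by rewrite !mul_frame !vec3E !scale0r !scale1r !add0r !addr0.
Qed.

Lemma dot_frame G (z w : 'rV[R]_3) p q e :
  dot G (z *m frame p q e) (w *m frame p q e) =
  z 0 0 * w 0 0 * dot G p p + z 0 1 * w 0 1 * dot G q q + z 0 2 * w 0 2 * dot G e e +
  (z 0 0 * w 0 1 + z 0 1 * w 0 0) * dot G p q +
  (z 0 0 * w 0 2 + z 0 2 * w 0 0) * dot G p e +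
  (z 0 1 * w 0 2 + z 0 2 * w 0 1) * dot G q e.
Proof.
rewrite !mul_frame !dotDl !dotDr !dotZl !dotZr (dotC _ q p) (dotC _ e p) (dotC _ e q).
ring.
Qed.

Lemma frame_plane (z : 'rV[R]_3) p q e :
  in_plane Euclidean p -> in_plane Euclidean q -> in_plane Euclidean e ->
  (z *m frame p q e) 0 0 = z 0 0 + z 0 1 + z 0 2.
Proof. by rewrite mul_frame !mxE /= => -> -> ->; rewrite !mulr1. Qed.

(** Separations determine the squared length of the combinations with coefficient
    sum zero, which are the differences of points of the plane. *)
Lemma dot_barycentric (z : 'rV[R]_3) p q e : z 0 0 + z 0 1 + z 0 2 = 0 ->
  dot Euclidean (z *m frame p q e) (z *m frame p q e) =
  - (z 0 0 * z 0 1 * separation Euclidean p q + z 0 0 * z 0 2 * separation Euclidean p e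
     + z 0 1 * z 0 2 * separation Euclidean q e).
Proof.
move=> z0; rewrite dot_frame /separation !dotBl !dotBr.
rewrite (dotC _ q p) (dotC _ e p) (dotC _ e q).
have -> : z 0 2 = - (z 0 0 + z 0 1) by lra.
ring.
Qed.

Lemma euclidean_definite x : x 0 0 = 0 -> dot Euclidean x x = 0 -> x = 0.
Proof.
move=> x0 /eqP; rewrite /dot paddr_eq0 -?expr2 ?sqr_ge0// !sqrf_eq0 => /andP[/eqP x1 /eqP x2].
apply/rowP => i; rewrite mxE; case: i => -[|[|[|//]]] hi.
- by rewrite -[RHS]x0; congr (x _ _); exact: val_inj.
- by rewrite -[RHS]x1; congr (x _ _); exact: val_inj.
- by rewrite -[RHS]x2; congr (x _ _); exact: val_inj.
Qed.

Lemma vec_eq0 (z : 'rV[R]_3) : z 0 0 = 0 -> z 0 1 = 0 -> z 0 2 = 0 -> z = 0.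
Proof.
by move=> z0 z1 z2; apply: euclidean_definite => //; rewrite /dot z1 z2; ring.
Qed.

(** The Gram matrix of the three vertices of a triangle is invertible. *)
Lemma hyperbolic_nondegenerate th u v p q e (z : 'rV[R]_3) : 0 < th < pi ->
  radius_domain Hyperbolic u -> radius_domain Hyperbolic v ->
  kite_triangle Hyperbolic th u v p q e ->
  let x := z *m frame p q e in
  dot Hyperbolic x p = 0 -> dot Hyperbolic x q = 0 -> dot Hyperbolic x e = 0 -> z = 0.
Proof.
move=> hth hu hv [[[pp _] [qq _] [ee _]] [pe qe pq]] x.
have s2 : sin th ^+ 2 = 1 - cos th ^+ 2 by rewrite -(cos2Dsin2 th); ring.
have s0 : 0 < sin th ^+ 2 by rewrite exprn_gt0// sin_gt0_of.
have su := sinh_half_gt0 hu; have sv := sinh_half_gt0 hv.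
have cu2 : cosh_half u ^+ 2 = 1 + sinh_half u ^+ 2.
  by apply: cosh_half2; case: hu => -> ->.
have cv2 : cosh_half v ^+ 2 = 1 + sinh_half v ^+ 2.
  by apply: cosh_half2; case: hv => -> ->.
move: pe qe pq; rewrite /separation => /(canRL (@opprK _)) pe /(canRL (@opprK _)) qe
  /(canRL (@opprK _)) pq.
rewrite /x mul_frame !dotDl !dotZl pp qq ee (dotC _ q p) (dotC _ e p) (dotC _ e q) pe qe pq.
rewrite /separation_at /opposite_separation.
move: cu2 cv2 su sv; set a := cosh_half u; set b := cosh_half v.
set c := sinh_half u; set d := sinh_half v; set k := cos th in s2 *.
move=> a2 b2 c0 d0 h1 h2 h3.
have e2 : z 0 2 = - (z 0 0 * a + z 0 1 * b) by lra.
have f1 : c * (z 0 0 * c + z 0 1 * (d * k)) = 0.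
  transitivity (z 0 0 * (a ^+ 2 - 1) + z 0 1 * (c * d * k)); first by rewrite a2; ring.
  by move: h1; rewrite e2 => h1; rewrite -[RHS]h1; ring.
have f2 : d * (z 0 0 * (c * k) + z 0 1 * d) = 0.
  transitivity (z 0 1 * (b ^+ 2 - 1) + z 0 0 * (c * d * k)); first by rewrite b2; ring.
  by move: h2; rewrite e2 => h2; rewrite -[RHS]h2; ring.
have g1 : z 0 0 * c + z 0 1 * (d * k) = 0.
  by apply: (@mulfI _ c); rewrite ?gt_eqF// mulr0.
have g2 : z 0 0 * (c * k) + z 0 1 * d = 0.
  by apply: (@mulfI _ d); rewrite ?gt_eqF// mulr0.
have z1 : z 0 1 = 0.
  apply: (@mulfI _ (d * sin th ^+ 2)); first by rewrite gt_eqF// mulr_gt0.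
  rewrite mulr0 s2.
  transitivity ((z 0 0 * (c * k) + z 0 1 * d) - k * (z 0 0 * c + z 0 1 * (d * k))); first ring.
  by rewrite g1 g2; ring.
have z0 : z 0 0 = 0.
  by apply: (@mulfI _ c); rewrite ?gt_eqF// mulr0; move: g1; rewrite z1; lra.
by apply: vec_eq0 => //; rewrite e2 z0 z1; ring.
Qed.

Lemma euclidean_nondegenerate th u v p q e (z : 'rV[R]_3) : 0 < th < pi ->
  radius_domain Euclidean u -> radius_domain Euclidean v ->
  kite_triangle Euclidean th u v p q e -> z *m frame p q e = 0 -> z = 0.
Proof.
move=> hth [u0 _] [v0 _] [[pP qP eP] [pe qe pq]] z0.
have s2 : sin th ^+ 2 = 1 - cos th ^+ 2 by rewrite -(cos2Dsin2 th); ring.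
have s0 := sin_gt0_of hth.
have zs : z 0 0 + z 0 1 + z 0 2 = 0 by rewrite -(frame_plane z pP qP eP) z0 mxE.
have := dot_barycentric p q e zs; rewrite z0 pe qe pq /separation_at /opposite_separation.
rewrite (_ : dot Euclidean 0 0 = 0); last by rewrite /dot !mxE; ring.
have e2 : z 0 2 = - (z 0 0 + z 0 1) by lra.
rewrite e2 => h.
have : (z 0 0 * u + z 0 1 * v * cos th) ^+ 2 + (z 0 1 * v * sin th) ^+ 2 = 0.
  by rewrite [(_ * sin th) ^+ 2]exprMn s2 h; ring.
move/eqP; rewrite paddr_eq0 ?sqr_ge0// !sqrf_eq0 => /andP[/eqP h1 /eqP h2].
have z1 : z 0 1 = 0.
  by apply: (@mulIf _ (v * sin th)); rewrite ?mul0r ?mulrA// gt_eqF// mulr_gt0.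
have zz0 : z 0 0 = 0.
  by apply: (@mulIf _ u); rewrite ?gt_eqF// mul0r; move: h1; rewrite z1; lra.
by apply: vec_eq0 => //; rewrite e2 zz0 z1; ring.
Qed.

Lemma frame_unit G th u v p q e : 0 < th < pi ->
  radius_domain G u -> radius_domain G v -> kite_triangle G th u v p q e ->
  frame p q e \in unitmx.
Proof.
move=> hth hu hv hk; rewrite -row_free_unit; apply: inj_row_free => z z0.
case: G hu hv hk => hu hv hk; first exact: (euclidean_nondegenerate hth hu hv hk).
by apply: (hyperbolic_nondegenerate hth hu hv hk); rewrite z0 /dot !mxE; ring.
Qed.

Lemma frame_coordinates G th u v p q e x : 0 < th < pi ->
  radius_domain G u -> radius_domain G v -> kite_triangle G th u v p q e ->
  exists z, x = z *m frame p q e.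
Proof.
by move=> hth hu hv hk; exists (x *m invmx (frame p q e)); rewrite mulmxKV// (frame_unit hth hu hv hk).
Qed.

(** Two circles meet in at most two points.  The difference of two common points is
    orthogonal to the line through the centres; in terms of the frame this fixes
    the coefficient of [e] (or the sum of the other two), and then everything. *)
Lemma endpoint_unique G th u v p q e x y : 0 < th < pi ->
  radius_domain G u -> radius_domain G v -> kite_triangle G th u v p q e ->
  in_plane G x -> in_plane G y ->
  separation G p x = separation_at G u -> separation G q x = separation_at G v ->
  separation G p y = separation_at G u -> separation G q y = separation_at G v ->
  x != e -> y != e -> x = y.
Proof.
move=> hth hu hv hk; case: (hk) => -[pP qP eP] [pe qe pq] xP yP px qx py qy xe ye.
have [z zE] := frame_coordinates (x - e) hth hu hv hk.
have [w wE] := frame_coordinates (y - e) hth hu hv hk.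
apply/eqP; rewrite -subr_eq0; apply/eqP.
have xyE : x - y = (z - w) *m frame p q e by rewrite mulmxBl -zE -wE opprB addrA subrK.
case: G hu hv hk pP qP eP pe qe pq xP yP px qx py qy => hu hv hk pP qP eP pe qe pq xP yP px qx py qy.
  have key (x' : 'rV[R]_3) (z' : 'rV[R]_3) : in_plane Euclidean x' -> x' != e ->
      x' - e = z' *m frame p q e ->
      separation Euclidean p x' = separation_at Euclidean u ->
      separation Euclidean q x' = separation_at Euclidean v ->
      [/\ z' 0 0 + z' 0 1 = 2, z' 0 0 + z' 0 1 + z' 0 2 = 0 &
        dot Euclidean (x' - e) (p - q) = 0].
    move=> x'P x'e z'E px' qx'.
    have zs : z' 0 0 + z' 0 1 + z' 0 2 = 0.
      by rewrite -(frame_plane z' pP qP eP) -z'E !mxE x'P eP subrr.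
    have ep : 2 * dot Euclidean (x' - e) (p - e) = dot Euclidean (x' - e) (x' - e).
      have := px'; rewrite -pe /separation (_ : p - x' = (p - e) - (x' - e)); last first.
        by rewrite opprB addrA subrK.
      by rewrite dot_square_sub; lra.
    have eq : 2 * dot Euclidean (x' - e) (q - e) = dot Euclidean (x' - e) (x' - e).
      have := qx'; rewrite -qe /separation (_ : q - x' = (q - e) - (x' - e)); last first.
        by rewrite opprB addrA subrK.
      by rewrite dot_square_sub; lra.
    have xx0 : dot Euclidean (x' - e) (x' - e) != 0.
      apply/eqP => /euclidean_definite; rewrite !mxE x'P eP subrr => /(_ erefl)/eqP.
      by rewrite subr_eq0 (negbTE x'e).
    have ex : x' - e = z' 0 0 *: (p - e) + z' 0 1 *: (q - e).
      rewrite z'E mul_frame (_ : z' 0 2 = - (z' 0 0 + z' 0 1)); last lra.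
      rewrite !scalerBr scaleNr scalerDl; apply/rowP => i; rewrite !mxE; ring.
    split=> //; last first.
      rewrite (_ : p - q = (p - e) - (q - e)); last by rewrite opprB addrA subrK.
      by rewrite dotBr; lra.
    apply: (mulIf xx0).
    have h : dot Euclidean (x' - e) (x' - e) = z' 0 0 * dot Euclidean (x' - e) (p - e) +
        z' 0 1 * dot Euclidean (x' - e) (q - e) by rewrite -!dotZr -dotDr -ex.
    transitivity (2 * (z' 0 0 * dot Euclidean (x' - e) (p - e) +
        z' 0 1 * dot Euclidean (x' - e) (q - e))); last by rewrite -h.
    by rewrite mulrDl -{1}ep -eq; ring.
  have [z2 zs zd] := key x z xP xe zE px qx.
  have [w2 ws wd] := key y w yP ye wE py qy.
  have d2 : z 0 2 - w 0 2 = 0 by lra.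
  have xyd : x - y = (z 0 0 - w 0 0) *: (p - q).
    rewrite xyE mul_frame !mxE d2 scale0r addr0.
    rewrite (_ : z 0 1 - w 0 1 = - (z 0 0 - w 0 0)); last lra.
    by rewrite scaleNr scalerBr.
  have : dot Euclidean (x - y) (p - q) = 0.
    rewrite (_ : x - y = (x - e) - (y - e)); last by rewrite opprB addrA subrK.
    by rewrite dotBl zd wd subrr.
  rewrite xyd dotZl => /eqP; rewrite mulf_eq0 => /orP[/eqP->|]; first by rewrite scale0r.
  case: hu hv => u0 _ [v0 _]; have [_ h] := euclidean_opposite_square u hth v0.
  by move: pq h => /= <- h; rewrite gt_eqF.
have [pp _] := pP; have [qq _] := qP; have [ee _] := eP.
have key (x' : 'rV[R]_3) (z' : 'rV[R]_3) : in_plane Hyperbolic x' -> x' != e ->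
    x' - e = z' *m frame p q e ->
    separation Hyperbolic p x' = separation_at Hyperbolic u ->
    separation Hyperbolic q x' = separation_at Hyperbolic v ->
    [/\ z' 0 2 = - 2, dot Hyperbolic (x' - e) p = 0 & dot Hyperbolic (x' - e) q = 0].
  move=> [x'x' _] x'e z'E px' qx'.
  have dp : dot Hyperbolic (x' - e) p = 0.
    by rewrite dotBl !(dotC _ _ p); move: px' pe; rewrite /separation; lra.
  have dq : dot Hyperbolic (x' - e) q = 0.
    by rewrite dotBl !(dotC _ _ q); move: qx' qe; rewrite /separation; lra.
  have xx : dot Hyperbolic (x' - e) (x' - e) = - 2 * dot Hyperbolic (x' - e) e.
    by rewrite dot_square_sub dotBl x'x' ee (dotC _ e); ring.
  have h : dot Hyperbolic (x' - e) (x' - e) = z' 0 2 * dot Hyperbolic (x' - e) e.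
    by rewrite {2}z'E mul_frame !dotDr !dotZr dp dq; ring.
  split=> //; apply: (@mulIf _ (dot Hyperbolic (x' - e) e)); last by rewrite -xx -h.
  apply/eqP => de; move: dp dq de; rewrite z'E => dp dq de.
  have z0 := hyperbolic_nondegenerate hth hu hv hk dp dq de.
  by move/eqP: z'E; rewrite z0 mul0mx subr_eq0 (negbTE x'e).
have [z2 zp zq] := key x z xP xe zE px qx.
have [w2 wp wq] := key y w yP ye wE py qy.
have d2 : z 0 2 - w 0 2 = 0 by rewrite z2 w2 subrr.
set a := z 0 0 - w 0 0; set b := z 0 1 - w 0 1.
have xyd : x - y = a *: p + b *: q by rewrite xyE mul_frame !mxE d2 scale0r addr0.
have ddp : dot Hyperbolic (x - y) p = 0.
  rewrite (_ : x - y = (x - e) - (y - e)); last by rewrite opprB addrA subrK.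
  by rewrite dotBl zp wp subrr.
have ddq : dot Hyperbolic (x - y) q = 0.
  rewrite (_ : x - y = (x - e) - (y - e)); last by rewrite opprB addrA subrK.
  by rewrite dotBl zq wq subrr.
have [_ hL] := hyperbolic_opposite_square hth hu hv; rewrite -pq /separation in hL.
move: ddp ddq hL; rewrite xyd !dotDl !dotZl pp qq (dotC _ q p).
set L := dot Hyperbolic p q => h1 h2; rewrite sqrrN => hL.
have b0 : b = 0.
  apply: (@mulIf _ (L ^+ 2 - 1)); first by rewrite gt_eqF.
  rewrite mul0r; transitivity ((a * L + b * - 1) + L * (a * - 1 + b * L)); first ring.
  by rewrite h1 h2; ring.
have a0 : a = 0 by move: h1; rewrite b0; lra.
by rewrite a0 b0 !scale0r addr0.
Qed.

(** The reversed Cauchy-Schwarz inequality separates the two sheets of the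
    hyperboloid. *)
Lemma hyperbolic_sheet x y : dot Hyperbolic x x = -1 -> in_plane Hyperbolic y ->
  (0 < x 0 0) = (dot Hyperbolic x y < 0).
Proof.
move=> xx [yy y0].
have cs : (x 0 1 * y 0 1 + x 0 2 * y 0 2) ^+ 2 < (x 0 0 * y 0 0) ^+ 2.
  have hx : x 0 0 ^+ 2 = 1 + (x 0 1 ^+ 2 + x 0 2 ^+ 2) by move: xx; rewrite /dot; nra.
  have hy : y 0 0 ^+ 2 = 1 + (y 0 1 ^+ 2 + y 0 2 ^+ 2) by move: yy; rewrite /dot; nra.
  rewrite [ltRHS]exprMn hx hy -subr_gt0.
  rewrite (_ : _ - _ = 1 + (x 0 1 ^+ 2 + x 0 2 ^+ 2) + (y 0 1 ^+ 2 + y 0 2 ^+ 2) +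
    (x 0 1 * y 0 2 - x 0 2 * y 0 1) ^+ 2); last ring.
  by rewrite !(ltr_wpDr, sqr_ge0, addr_ge0)// ltr01.
rewrite /dot; set s := _ + _ in cs *; set t := x 0 0 * y 0 0 in cs *.
have ts : (0 < x 0 0) = (0 < t) by rewrite /t pmulr_lgt0.
rewrite ts; apply/idP/idP => h; first by nra.
rewrite ltNge; apply/negP => t0; nra.
Qed.

(** The hyperbolic plane has no similarities other than isometries. *)
Definition admissible_scale G (l : R) : Prop := if G is Hyperbolic then l = 1 else True.

Definition separation_scale G (l : R) : R := if G is Hyperbolic then 1 else l ^+ 2.

(** In both models the three vertices of a triangle are a basis of the ambient
    space, so a map of triangles extends to a linear map. *)
Definition frame_map p q e p' q' e' : 'M[R]_3 := invmx (frame p q e) *m frame p' q' e'.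

Section FrameMap.
Variables (G : geometry) (th u v l : R) (p q e p' q' e' : 'rV[R]_3).
Hypotheses (hth : 0 < th < pi) (l0 : 0 < l) (hl : admissible_scale G l).
Hypotheses (hu : radius_domain G u) (hv : radius_domain G v).
Hypothesis hk : kite_triangle G th u v p q e.
Hypothesis hk' : kite_triangle G th (l * u) (l * v) p' q' e'.
Let M := frame_map p q e p' q' e'.

Lemma frame_mapE (z : 'rV[R]_3) : z *m frame p q e *m M = z *m frame p' q' e'.
Proof. by rewrite /M /frame_map mulmxA mulmxK// (frame_unit hth hu hv hk). Qed.

Lemma frame_map_points : [/\ p *m M = p', q *m M = q' & e *m M = e'].
Proof.
have [z1 [z2 [z3 h]]] := frame_rows p q e; have [h1 h2 h3] := h p q e.
have [h1' h2' h3'] := h p' q' e'.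
by split; [rewrite -{1}h1|rewrite -{1}h2|rewrite -{1}h3]; rewrite frame_mapE.
Qed.

Lemma separation_scaled :
  [/\ separation G p' e' = separation_scale G l * separation G p e,
      separation G q' e' = separation_scale G l * separation G q e &
      separation G p' q' = separation_scale G l * separation G p q].
Proof.
case: hk => _ [-> -> ->]; case: hk' => _ [-> -> ->].
rewrite /separation_at /opposite_separation /separation_scale.
by case: (G) hl => [_|->]; rewrite ?mul1r//; split; ring.
Qed.

Lemma frame_map_in_plane x : in_plane G x -> in_plane G (x *m M).
Proof.
have [z ->] := frame_coordinates x hth hu hv hk; rewrite frame_mapE.
have [s1 s2 s3] := separation_scaled.
have [[pP qP eP] _] := hk; have [[pP' qP' eP'] _] := hk'.
move: s1 s2 s3 hl pP qP eP pP' qP' eP'; case: (G) => s1 s2 s3 hl' pP qP eP pP' qP' eP'.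
  by rewrite /in_plane !frame_plane.
have [pp _] := pP; have [qq _] := qP; have [ee _] := eP.
have [pp' _] := pP'; have [qq' _] := qP'; have [ee' _] := eP'.
move: s1 s2 s3; rewrite /separation_scale !mul1r /separation => /oppr_inj s1 /oppr_inj s2 /oppr_inj s3.
have E (w : 'rV[R]_3) : dot Hyperbolic (z *m frame p' q' e') (w *m frame p' q' e') =
    dot Hyperbolic (z *m frame p q e) (w *m frame p q e).
  by rewrite !dot_frame pp qq ee pp' qq' ee' s1 s2 s3.
case=> zz z0; split; first by rewrite E.
have [z1 [z2 [z3 h]]] := frame_rows p q e; have [h1 _ _] := h p q e; have [h1' _ _] := h p' q' e'.
have := E z1; rewrite h1 h1' => e2.
by rewrite (@hyperbolic_sheet _ p') ?E// e2 -hyperbolic_sheet.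
Qed.

Lemma frame_map_separation x y : in_plane G x -> in_plane G y ->
  separation G (x *m M) (y *m M) = separation_scale G l * separation G x y.
Proof.
have [z ->] := frame_coordinates x hth hu hv hk.
have [w ->] := frame_coordinates y hth hu hv hk; rewrite !frame_mapE.
have [s1 s2 s3] := separation_scaled.
have [[pP qP eP] _] := hk; have [[pP' qP' eP'] _] := hk'.
move: s1 s2 s3 hl pP qP eP pP' qP' eP'; case: (G) => s1 s2 s3 hl' pP qP eP pP' qP' eP' zP wP.
  rewrite /separation -!mulmxBl; have zw : (z - w) 0 0 + (z - w) 0 1 + (z - w) 0 2 = 0.
    by rewrite -(frame_plane (z - w) pP qP eP) mulmxBl mxE [X in _ + X]mxE zP wP subrr.
  by rewrite !dot_barycentric// s1 s2 s3; ring.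
have [pp _] := pP; have [qq _] := qP; have [ee _] := eP.
have [pp' _] := pP'; have [qq' _] := qP'; have [ee' _] := eP'.
move: s1 s2 s3; rewrite /separation_scale !mul1r /separation => /oppr_inj s1 /oppr_inj s2 /oppr_inj s3.
by rewrite !dot_frame pp qq ee pp' qq' ee' s1 s2 s3.
Qed.

Lemma frame_map_dist x y : in_plane G x -> in_plane G y ->
  dist G (x *m M) (y *m M) = l * dist G x y.
Proof.
move=> xP yP; have := frame_map_separation xP yP; move: hl {xP yP}; case: (G) => hl'.
  by rewrite /separation /= => ->; rewrite sqrtrM ?sqr_ge0// sqrtr_sqr gtr0_norm.
by rewrite /separation /dist /separation_scale mul1r hl' mul1r => ->.
Qed.

End FrameMap.

(** The inverse matrix [N] is part of the data, which makes the notion symmetric. *)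
Definition plane_similarity G (l : R) (M N : 'M[R]_3) : Prop :=
  [/\ M *m N = 1%:M, N *m M = 1%:M,
    forall x, in_plane G x -> in_plane G (x *m M),
    forall x, in_plane G x -> in_plane G (x *m N) &
    forall x y, in_plane G x -> in_plane G y ->
      dist G (x *m M) (y *m M) = l * dist G x y].

Lemma plane_similarity_sym G l M N : 0 < l ->
  plane_similarity G l M N -> plane_similarity G l^-1 N M.
Proof.
move=> l0 [MN NM hM hN hd]; split=> // x y xP yP.
apply: (@mulfI _ l); first by rewrite gt_eqF.
have := hd (x *m N) (y *m N) (hN _ xP) (hN _ yP); rewrite -!mulmxA NM !mulmx1 => <-.
by rewrite mulrA divff ?mul1r// gt_eqF.
Qed.

(** The linear map between the triangles at [e1] also respects the other
    intersection point, by [endpoint_unique]. *)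
Lemma kite_congruence G th u v l p q e1 e2 p' q' e1' e2' : 0 < th < pi -> 0 < l ->
  admissible_scale G l ->
  radius_domain G u -> radius_domain G v ->
  kite_points G th u v p q e1 e2 ->
  kite_points G th (l * u) (l * v) p' q' e1' e2' ->
  exists M N, plane_similarity G l M N /\
    [/\ p *m M = p', q *m M = q', e1 *m M = e1' & e2 *m M = e2'].
Proof.
move=> hth l0 hl hu hv [k1 k2 ne] [k1' k2' ne'].
have dom w : radius_domain G w -> radius_domain G (l * w).
  by case: (G) hl => [_|->]; rewrite ?mul1r// => -[w0 _]; split=> //; rewrite mulr_gt0.
have hu' := dom _ hu; have hv' := dom _ hv.
have U := frame_unit hth hu hv k1; have U' := frame_unit hth hu' hv' k1'.
pose M := frame_map p q e1 p' q' e1'; pose N := frame_map p' q' e1' p q e1.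
have li : 0 < l^-1 by rewrite invr_gt0.
have hli : admissible_scale G l^-1.
  by move: hl; rewrite /admissible_scale; case: (G) => // ->; rewrite invr1.
have k1i : kite_triangle G th (l^-1 * (l * u)) (l^-1 * (l * v)) p q e1.
  by rewrite !mulKf// gt_eqF.
have MN : M *m N = 1%:M by rewrite /M /N /frame_map mulmxA mulmxK// mulVmx.
have NM : N *m M = 1%:M by rewrite /M /N /frame_map mulmxA mulmxK// mulVmx.
have [pM qM eM] := frame_map_points p' q' e1' hth hu hv k1.
exists M, N; split.
  split=> //.
  - by move=> x; exact: (frame_map_in_plane hth hl hu hv k1 k1').
  - by move=> x; exact: (frame_map_in_plane hth hli hu' hv' k1' k1i).
  - by move=> x y; exact: (frame_map_dist hth l0 hl hu hv k1 k1').
split=> //; have [[pP qP eP] [pe qe _]] := k2; have [[pP' qP' eP'] [pe' qe' _]] := k2'.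
have sep := frame_map_separation hth hl hu hv k1 k1'.
have scl w : separation_scale G l * separation_at G w = separation_at G (l * w).
  by rewrite /separation_scale /separation_at; case: (G) hl => [_|->]; rewrite ?mul1r//; ring.
apply: (endpoint_unique hth hu' hv' k1') => //.
- exact: (frame_map_in_plane hth hl hu hv k1 k1').
- by rewrite -pM sep// pe scl.
- by rewrite -qM sep// qe scl.
- apply: contra ne => /eqP h; apply/eqP.
  by rewrite -[e1]mulmx1 -[e2]mulmx1 -MN (mulmxA e1) (mulmxA e2) h eM.
- by rewrite eq_sym.
Qed.

End Congruence.

(** * Patterns and radii *)

(** The two darts of an edge share a kite.  This predicate selects the one that
    determines its place, or its map to the kite of another pattern. *)
Definition first_dart (S : cellular_surface) (d : dart S) : bool :=
  (enum_rank d < enum_rank (rev S d))%N.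

Lemma first_dart_rev (S : cellular_surface) (d : dart S) :
  first_dart (rev S d) = ~~ first_dart d.
Proof.
rewrite /first_dart revK ltn_neqAle -leqNgt (inj_eq (@ord_inj _)) (inj_eq enum_rank_inj).
by rewrite rev_neq.
Qed.

Section Patterns.
Variables (R : realType) (S : cellular_surface) (theta : edge S -> R) (G : geometry).
Hypothesis htheta : forall e, 0 < theta e < pi.
Implicit Types (P Q : circle_pattern theta G) (d : dart S) (f : face S).

Definition radii P f : R := radius_param G (radius P f).

Lemma radii_domain P f : radius_domain G (radii P f).
Proof. exact/radius_param_domain/radius_gt0. Qed.

Lemma pattern_kite P d :
  kite_points G (theta (edge_of d)) (radii P (left_face d)) (radii P (left_face (rev S d)))
    (center P d) (center P (rev S d)) (endpoint P d) (endpoint P (rev S d)).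
Proof.
case/andP: (htheta (edge_of d)) => t0 _; have cP := center_in_plane P.
have eP := endpoint_in_plane P; split; last exact: endpoint_neq.
  apply: triangle_of_angle => //; try exact: radius_gt0.
  - exact: side_initial.
  - by rewrite -{2}[d](@revK S); exact: side_terminal.
  - exact: endpoint_angle.
apply/kite_triangleC; apply: triangle_of_angle => //; try exact: radius_gt0.
- exact: side_initial.
- exact: side_terminal.
- by have := endpoint_angle P (rev S d); rewrite revK edge_of_rev.
Qed.

Lemma center_angleE P d : center_angle P d = 2 * dart_angle theta G (radii P) d.
Proof.
have [k1 k2 _] := pattern_kite P d; rewrite /center_angle.
by rewrite !(angle_at_center (htheta _) (radii_domain P _) (radii_domain P _) k1,
  angle_at_center (htheta _) (radii_domain P _) (radii_domain P _) k2) /dart_angle; ring.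
Qed.

Lemma cone_angleE P f :
  \sum_(d in val f) center_angle P d = 2 * half_cone_angle theta G (radii P) f.
Proof. by rewrite mulr_sumr; apply: eq_bigr => d _; exact: center_angleE. Qed.

Lemma half_cone_angle_pi P : no_cone_singularities P ->
  forall f, half_cone_angle theta G (radii P) f = pi.
Proof. by case=> h _ f; have := h f; rewrite cone_angleE => /mulfI; apply. Qed.

Lemma pattern_exists (u : face S -> R) :
  (forall v : vertex S, \sum_(d in val v) theta (edge_of d) = 2 * pi) ->
  (forall f, radius_domain G (u f)) ->
  (forall f, half_cone_angle theta G u f = pi) ->
  exists P, no_cone_singularities P.
Proof.
move=> hsum hu hpi; pose V := 'rV[R]_3.
have /boolp.choice[K hK] (d : dart S) : exists k : V * V * V * V,
    kite_points G (theta (edge_of d)) (u (left_face d)) (u (left_face (rev S d)))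
      k.1.1.1 k.1.1.2 k.1.2 k.2.
  have [p [q [e [e' h]]]] := kite_exists (htheta (edge_of d)) (hu (left_face d))
    (hu (left_face (rev S d))).
  by exists (p, q, e, e').
pose c d := if first_dart d then (K d).1.1.1 else (K (rev S d)).1.1.2.
pose e d := if first_dart d then (K d).1.2 else (K (rev S d)).2.
have kK d : kite_points G (theta (edge_of d)) (u (left_face d)) (u (left_face (rev S d)))
    (c d) (c (rev S d)) (e d) (e (rev S d)).
  rewrite /c /e first_dart_rev; case: (boolP (first_dart d)) => fd /=; first by rewrite revK; exact: hK.
  have [k1 k2 ne] := hK (rev S d); rewrite revK edge_of_rev in k1 k2.
  by split; [exact/kite_triangleC|exact/kite_triangleC|rewrite eq_sym].
pose r f := param_radius G (u f).
have r0 f : 0 < r f by exact: param_radius_gt0.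
have cP d : in_plane G (c d) by have [[[]]] := kK d.
have eP d : in_plane G (e d) by have [[[]]] := kK d.
have s1 d : dist G (c d) (e d) = r (left_face d).
  by have [[_ [h _ _]] _ _] := kK d; exact: separation_dist.
have s2 d : dist G (c d) (e (rev S d)) = r (left_face d).
  by have [_ [_ [h _ _]] _] := kK d; exact: separation_dist.
have ne d : e d != e (rev S d) by have [] := kK d.
have an d : angle G (e d) (c d) (c (rev S d)) = theta (edge_of d).
  by have [h _ _] := kK d; exact: (angle_at_endpoint (htheta _) _ _ h).
pose P := @CirclePattern R S theta G r c e r0 cP eP s1 s2 ne an.
have rP : radii P = u by apply/funext => f; exact: param_radiusK.
exists P; split=> [f|v]; first by rewrite cone_angleE rP hpi.
by rewrite -(hsum v); apply: eq_bigr => d _; exact: an.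
Qed.

End Patterns.

(** * Similarity of patterns with proportional radii *)

Section Transport.
Variables (R : realType) (S : cellular_surface) (theta : edge S -> R) (G : geometry).
Implicit Types (P Q : circle_pattern theta G) (d : dart S).
Implicit Types (M N : dart S -> 'M[R]_3) (p q : dart S * 'rV[R]_3).

(** One map for both darts of an edge, as their kites are glued by the identity. *)
Definition kite_maps P Q (l : R) M N : Prop := forall d,
  [/\ plane_similarity G l (M d) (N d), M (rev S d) = M d, N (rev S d) = N d,
      center P d *m M d = center Q d & endpoint P d *m M d = endpoint Q d].

Lemma kite_maps_sym P Q l M N : 0 < l -> kite_maps P Q l M N -> kite_maps Q P l^-1 N M.
Proof.
move=> l0 h d; have [hM rM rN <- <-] := h d; have [MN _ _ _ _] := hM.
by split=> //; [exact: plane_similarity_sym|rewrite -mulmxA MN mulmx1|rewrite -mulmxA MN mulmx1].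
Qed.

Definition move M p : dart S * 'rV[R]_3 := (p.1, p.2 *m M p.1).

Section OneWay.
Variables (P Q : circle_pattern theta G) (l : R) (M N : dart S -> 'M[R]_3).
Hypotheses (l0 : 0 < l) (hMN : kite_maps P Q l M N).

Lemma segment_map d a b x : segment G a b x -> segment G (a *m M d) (b *m M d) (x *m M d).
Proof.
have [[_ _ hM _ _] _ _ _ _] := hMN d; case=> xP [s [t [s0 t0 xE]]]; split; first exact: hM.
by exists s, t; split=> //; rewrite xE mulmxDl -!scalemxAl.
Qed.

Lemma triangle_map d a b c x : triangle G a b c x ->
  triangle G (a *m M d) (b *m M d) (c *m M d) (x *m M d).
Proof.
have [[_ _ hM _ _] _ _ _ _] := hMN d.
case=> xP [s [t [v [s0 t0 v0 xE]]]]; split; first exact: hM.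
by exists s, t, v; split=> //; rewrite xE !mulmxDl -!scalemxAl.
Qed.

Lemma kite_map d x : kite P d x -> kite Q d (x *m M d).
Proof.
have [_ rM _ cE eE] := hMN d; have [_ _ _ cE' eE'] := hMN (rev S d).
rewrite rM in cE' eE'; rewrite /kite -cE -eE -cE' -eE'.
by case=> h; [left|right]; exact: triangle_map.
Qed.

Lemma map_dist d x y : in_plane G x -> in_plane G y ->
  dist G (x *m M d) (y *m M d) = l * dist G x y.
Proof. by have [[_ _ _ _ h] _ _ _ _] := hMN d; exact: h. Qed.

Lemma kite_in_plane d x : kite P d x -> in_plane G x.
Proof. by case=> -[]. Qed.

Lemma glue_step_map p q : glue_step P p q -> glue_step Q (move M p) (move M q).
Proof.
case=> [d x dx|d x y dx dy hd]; rewrite /move /=.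
  by have [_ -> _ _ _] := hMN d; apply: GlueRev; exact: kite_map.
have [_ _ _ cd ed] := hMN d; have [_ rM _ _ er] := hMN (rot S d).
have [_ _ _ cr _] := hMN (rev S (rot S d)); rewrite rM in cr.
apply: GlueSide.
- by rewrite -cd -ed; exact: segment_map.
- by rewrite -cr -er; exact: segment_map.
- rewrite -ed -er !map_dist ?hd//; try exact: endpoint_in_plane.
    by case: dy.
  by case: dx.
Qed.

Lemma glued_map p q : glued P p q -> glued Q (move M p) (move M q).
Proof.
elim=> [x y /glue_step_map h|x|x y _ h|x y z _ h1 _ h2].
- exact: rst_step.
- exact: rst_refl.
- exact: rst_sym.
- exact: rst_trans h1 h2.
Qed.

Lemma moveK : cancel (move M) (move N).
Proof.
by case=> d x; have [[MN _ _ _ _] _ _ _ _] := hMN d; rewrite /move /= -mulmxA MN mulmx1.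
Qed.

Lemma move_kite_point p : kite_point P p -> kite_point Q (move M p).
Proof. by case: p => d x; exact: kite_map. Qed.

End OneWay.

Lemma segment_kite_map P Q l M N d x y : 0 < l -> kite_maps P Q l M N ->
  (segment G x y `<=` kite P d)%classic ->
  (segment G (x *m M d) (y *m M d) `<=` kite Q d)%classic.
Proof.
move=> l0 h sub z /(segment_map (kite_maps_sym l0 h) d).
have [[MN NM _ _ _] _ _ _ _] := h d.
rewrite -!mulmxA MN !mulmx1 => /sub /(kite_map h); by rewrite -mulmxA NM mulmx1.
Qed.

Lemma broken_geodesic_map P Q l M N p q s : 0 < l -> kite_maps P Q l M N ->
  broken_geodesic P p q s -> broken_geodesic Q (move M p) (move M q) (l * s).
Proof.
move=> l0 h; elim=> [{}p {}q pk pq|d x y dx dy sub|{}p {}q q' s1 s2 _ h1 _ h2].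
- by rewrite mulr0; apply: BrokenSame; [exact: move_kite_point h _ pk|exact: (glued_map h)].
- rewrite /move /= -(map_dist h d (kite_in_plane dx) (kite_in_plane dy)).
  apply: BrokenSegment; [exact: (kite_map h)|exact: (kite_map h)|].
  exact: (segment_kite_map l0 h sub).
- by rewrite mulrDr; exact: BrokenCat h1 h2.
Qed.

(** Also valid where the infimum takes its default value [0]. *)
Lemma inf_scale (l : R) (A B : set R) : 0 < l ->
  (forall s, A s -> B (l * s)) -> (forall s, B s -> A (l^-1 * s)) -> inf B = l * inf A.
Proof.
move=> l0 AB BA; have li : 0 < l^-1 by rewrite invr_gt0.
have lK s : l * (l^-1 * s) = s by rewrite mulrA divff ?mul1r// gt_eqF.
have lK' s : l^-1 * (l * s) = s by rewrite mulrA mulVf ?mul1r// gt_eqF.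
have imp (k : R) (X Y : set R) : 0 < k -> (forall s, X s -> Y (k * s)) ->
    (forall s, Y s -> X (k^-1 * s)) -> has_inf X -> has_inf Y.
  move=> k0 XY YX [[s Xs] [m mX]]; split; first by exists (k * s); exact: XY.
  by exists (k * m) => t /YX /mX; rewrite ler_pdivlMl.
have le (k : R) (X Y : set R) : 0 < k -> (forall s, X s -> Y (k * s)) ->
    (forall s, Y s -> X (k^-1 * s)) -> has_inf X -> k * inf X <= inf Y.
  move=> k0 XY YX hX; have [Y0 _] := imp _ _ _ k0 XY YX hX.
  apply: lb_le_inf => // t /YX Xt; rewrite -ler_pdivlMl//.
  by apply: ge_inf => //; case: hX.
have [hA|hA] := pselect (has_inf A).
  have hB := imp _ _ _ l0 AB BA hA.
  apply/eqP; rewrite eq_le le// andbT -ler_pdivrMl//; apply: le => // s /AB.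
  by rewrite invrK.
have hB : ~ has_inf B.
  by move=> hB; apply/hA/(imp _ _ _ li BA _ hB) => s /AB; rewrite invrK.
by rewrite !inf_out// mulr0.
Qed.

Lemma kite_maps_similarity P Q l M N : 0 < l -> kite_maps P Q l M N ->
  (forall f, radius Q f = l * radius P f) -> similarity P Q l (fun d x => x *m M d).
Proof.
move=> l0 h hr; have h' := kite_maps_sym l0 h.
have mK := moveK h; have mK' := moveK h'.
split=> //.
- move=> d; apply/seteqP; split=> [_ [x dx <-]|y dy]; first exact: (kite_map h).
  exists (y *m N d); first exact: (kite_map h').
  by have [[_ NM _ _ _] _ _ _ _] := h d; rewrite -mulmxA NM mulmx1.
- move=> p q _ _; split; first exact: (glued_map h).
  by move/(glued_map h'); rewrite !mK.
- move=> p q _ _; apply: inf_scale => // s; first exact: (broken_geodesic_map l0 h).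
  have li : 0 < l^-1 by rewrite invr_gt0.
  by move/(broken_geodesic_map li h'); rewrite !mK.
- by move=> d; have [] := h d.
Qed.

Hypothesis htheta : forall e, 0 < theta e < pi.

Lemma kite_maps_exist P Q l : 0 < l -> admissible_scale G l ->
  (forall f, radii Q f = l * radii P f) -> exists M N, kite_maps P Q l M N.
Proof.
move=> l0 hl hr.
have /boolp.choice[K hK] (d : dart S) : exists k : 'M[R]_3 * 'M[R]_3,
   plane_similarity G l k.1 k.2 /\
   [/\ center P d *m k.1 = center Q d, center P (rev S d) *m k.1 = center Q (rev S d),
       endpoint P d *m k.1 = endpoint Q d & endpoint P (rev S d) *m k.1 = endpoint Q (rev S d)].
  have kQ := pattern_kite htheta Q d; rewrite !hr in kQ.
  have [M [N h]] := kite_congruence (htheta _) l0 hl (radii_domain P _) (radii_domain P _)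
    (pattern_kite htheta P d) kQ.
  by exists (M, N).
pose k d := if first_dart d then K d else K (rev S d).
have kr d : k (rev S d) = k d by rewrite /k first_dart_rev revK; case: (first_dart d).
exists (fun d => (k d).1), (fun d => (k d).2) => d; rewrite !kr /k.
case: (first_dart d); first by have [? []] := hK d.
by have [? []] := hK (rev S d); rewrite revK.
Qed.

End Transport.

(** * Existence and uniqueness *)

Section Existence.
Variables (R : realType) (S : cellular_surface) (g : nat) (theta : edge S -> R).
Hypotheses (hg : (0 < g)%N) (hS : has_genus S g).
Hypothesis htheta : forall e, 0 < theta e < pi.
Hypothesis hsum : forall v : vertex S, \sum_(d in val v) theta (edge_of d) = 2 * pi.

(** If all kites meet [F'] there is no cut, and the Gauss-Bonnet formula replaces
    the cut condition; in genus 1 it leaves nothing to spare for the set of all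
    faces. *)
Lemma hall_of_cut (F' : {set face S}) : cut_condition (theta : edge (dual S) -> R) ->
  F' != finset.set0 -> (g = 1%N -> F' != [set: face S]%SET) ->
  2 * pi * #|F'|%:R < \sum_(d | incident F' d) (pi - theta (edge_of d)).
Proof.
move=> hcut F'0 hF'; have [hall|] := boolP [forall d, incident F' d]; last first.
  by rewrite negb_forall => /existsP hd; exact: hall_of_boundary.
have -> : \sum_(d | incident F' d) (pi - theta (edge_of d)) =
    \sum_d (pi - theta (edge_of d)).
  by apply: eq_bigl => d; exact: (forallP hall d).
rewrite (sum_angle_defects hsum hS) ltr_pM2l ?mulr_gt0 ?pi_gt0//.
have le_card : (#|F'| <= #|{: face S}|)%N by exact: max_card.
have : (#|F'| + 2 < #|{: face S}| + 2 * g)%N.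
  case: (ltngtP g 1) hg => [|g1 _|g1 _]; first by case: g.
    have aux (a b k : nat) : (a <= b -> 1 < k -> a + 2 < b + 2 * k)%N by clear; lia.
    exact: aux.
  rewrite g1 muln1 ltn_add2r; move: (hF' g1); rewrite -finset.properT => /proper_card.
  by rewrite cardsT.
by rewrite -(ltr_nat R) natrD [in X in _ < X]natrD natrM; lra.
Qed.

Lemma solution_of_cut : cut_condition (theta : edge (dual S) -> R) ->
  exists2 u : face S -> R, (forall f, radius_domain (geometry_of_genus g) (u f)) &
    (forall f, half_cone_angle theta (geometry_of_genus g) u f = pi).
Proof.
move=> hcut; rewrite /geometry_of_genus; case: eqP => g1.
  have [||u u0 hu] := @euclidean_solution R S theta htheta.
  - by rewrite (sum_angle_defects hsum hS) g1; congr (_ * _); ring.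
  - by move=> F' F'0 F'T; exact: hall_of_cut.
  - by exists u.
apply: hyperbolic_solution => //; first exact: pi_gt0.
by move=> F' F'0; apply: hall_of_cut => // /g1.
Qed.

Lemma cut_of_pattern (P : circle_pattern theta (geometry_of_genus g)) :
  no_cone_singularities P -> cut_condition (theta : edge (dual S) -> R).
Proof.
move=> hP; apply: (cut_condition_of_angles htheta hsum
  (phi := dart_angle theta (geometry_of_genus g) (radii P))).
- by move=> d; apply: center_half_angle_gt0 => //; exact: radii_domain.
- by move=> d; apply: dart_angle_sum_le => // f; case: (radii_domain P f).
- exact: half_cone_angle_pi.
Qed.

End Existence.

Theorem theorem4 (R : realType) (S : cellular_surface) (g : nat)
  (hg : (0 < g)%N) (hS : has_genus S g)
  (theta : edge S -> R)
  (htheta : forall e, 0 < theta e < pi)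
  (hsum : forall v : vertex S, \sum_(d in val v) theta (edge_of d) = 2 * pi) :
  ((exists P : circle_pattern theta (geometry_of_genus g),
      no_cone_singularities P)
   <-> cut_condition (theta : edge (dual S) -> R)) /\
  (forall P Q : circle_pattern theta (geometry_of_genus g),
     no_cone_singularities P -> no_cone_singularities Q ->
     if g == 1%N then similar_patterns P Q else isometric_patterns P Q).
Proof.
split; first split.
- by case=> P hP; exact: (cut_of_pattern htheta hsum hP).
- move=> /(solution_of_cut hg hS htheta hsum)[u hu hpi].
  exact: (pattern_exists htheta hsum hu hpi).
rewrite /geometry_of_genus; case: eqP => _ P Q hP hQ.
  have u0 f := (radii_domain P f).1; have v0 f := (radii_domain Q f).1.
  have [f|l l0 hl] := euclidean_radii_unique htheta u0 v0.
    by rewrite !half_cone_angle_pi.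
  have [M [N hMN]] := kite_maps_exist htheta l0 (I : admissible_scale Euclidean l) hl.
  by exists l, (fun d x => x *m M d); split=> //; exact: (kite_maps_similarity l0 hMN).
have hr f : radii Q f = radii P f.
  apply: (hyperbolic_radii_unique htheta (radii_domain P) (radii_domain Q)) => f'.
  by rewrite !half_cone_angle_pi.
have [|M [N hMN]] := @kite_maps_exist R S theta Hyperbolic htheta P Q 1 ltr01 erefl.
  by move=> f; rewrite mul1r.
exists (fun d x => x *m M d); apply: (kite_maps_similarity ltr01 hMN) => f.
have := congr1 (param_radius Hyperbolic) (hr f).
by rewrite /radii !radius_paramK mul1r.
Qed.
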